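(* Let $d \geq 2$. If the direction set $\Omega \subseteq \mathbb R^{d+1}\setminus\{0\}$ is sublacunary (as a direction set), then $\Omega$ admits Kakeya-type sets.
   Context: **Lacunary sequences and sets in $\mathbb R$.** Let $A=\{a_1,a_2,\ldots\}$ be an infinite sequence of points contained in a compact subset of $\mathbb R$, and $0<\lambda<1$. $A$ is a lacunary sequence converging to $\alpha$ with lacunarity constant at most $\lambda$ if $|a_{j+1}-\alpha|\le\lambda|a_j-\alpha|$ for all $j\ge 1$. A lacunary set of order $0$ is a set of cardinality at most $1$ (these form $\Lambda(0;\lambda)$). Recursively, for an integer $N\ge 1$, a relatively compact $U\subseteq\mathbb R$ belongs to $\Lambda(N;\lambda)$ if there is a lacunary sequence $A$ with lacunarity constant $\le\lambda$ such that (a) $U\cap[\sup A,\infty)=\emptyset$ and $U\cap(-\infty,\inf A]=\emptyset$; (b) for any $a<b$ in $A$ with $(a,b)\cap A=\emptyset$, one has $U\cap[a,b)\in\Lambda(N-1;\lambda)$. **Lacunarity in affine spaces.** Let $\mathbb V$ be a $d$-dimensional affine subspace of a Euclidean space. For a base point $\mathbf a\in\mathbb V$ and an orthonormal basis $\mathcal B=\{\mathbf v_1,\ldots,\mathbf v_d\}$ of the linear space $\mathbb V-\mathbf a$, let $\pi_j(\mathbf a+\sum_i x_i\mathbf v_i)=x_j$. For a relatively compact $U\subseteq\mathbb V$, integers $N,R\ge1$ and $0<\lambda<1$, write $U\in\Lambda_d(N,\lambda,R;\mathbb V)$ if for every choice of $\mathbf a$, $\mathcal B$ and every $1\le j\le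 d$, the set $\pi_j(U)\subseteq\mathbb R$ can be covered by $R$ members of $\Lambda(N;\lambda)$. **Direction sets.** A direction set is a set $\Omega\subseteq\mathbb R^{d+1}\setminus\{0\}$, considered only up to positive rescaling of its elements. Put $\mathcal C_\Omega=\{r\omega: r>0,\ \omega\in\Omega\}$. $\Omega$ is admissible lacunary as a direction set, with order at most $N$ and lacunarity at most $\lambda$, if there is an integer $R$ such that $U\in\Lambda_d(N,\lambda,R;\mathbb V)$ for every hyperplane $\mathbb V\subset\mathbb R^{d+1}$ at unit distance from the origin and every relatively compact subset $U$ of $\mathcal C_\Omega\cap\mathbb V$. $\Omega$ is sublacunary if this fails for every $N$ and $\lambda$; i.e. for all integers $N,R\ge1$ and all $0<\lambda<1$ there are a hyperplane $\mathbb V$ at unit distance from the origin, a relatively compact $U\subseteq\mathcal C_\Omega\cap\mathbb V$ and a line $L$ in $\mathbb V$ such that the projection of $U$ onto $L$ cannot be covered by $R$ sets in $\Lambda(N;\lambda)$. **Kakeya-type sets.** A cylindrical tube (spherical cross-section) is oriented in direction $\omega$ if its principal axis is parallel to $\omega$. $\Omega$ admits Kakeya-type sets if for some fixed constant $A_0\ge1$ and every integer $N\ge1$ there are a number $0<\delta_N\ll1$, with $\delta_N\searrow0$ as $N\nearrow\infty$, and a collection of tubes $\{P_t^{(N)}\}$ with orientations in $\Omega$, length at least $1$ and cross-sectional radius at most $\delta_N$ (dimensions may vary from tube to tube), such that $$\lim_{N\to\infty}\frac{|E_N^*(A_0)|}{|E_N|}=\infty,\qquad E_N=\bigcup_tP_t^{(N)},\quad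 E_N^*(A_0)=\bigcup_tA_0P_t^{(N)},$$ where $|\cdot|$ is $(d+1)$-dimensional Lebesgue measure and $A_0P$ is the tube with the same centre, orientation and cross-sectional radius as $P$ but $A_0$ times its length. *)

(* Defs.v *)
From HB Require Import structures.
From mathcomp Require Import all_boot all_order all_algebra.
From mathcomp Require Import all_classical all_reals all_analysis.
Set Implicit Arguments.
Unset Strict Implicit.
Unset Printing Implicit Defensive.
Import Order.TTheory GRing.Theory Num.Theory.
Import numFieldNormedType.Exports.
Local Open Scope classical_set_scope.
Local Open Scope ring_scope.

(* Euclidean space R^n is 'rV[R]_n. *)

Section Lacunary.
Variable R : realType.
Implicit Types (lambda alpha : R) (a : nat -> R) (U : set R).

(* The sequence a_1, a_2, ... is indexed here from 0. *)
Definition lacunary_seq lambda a alpha : Prop :=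
  (exists2 K : set R, compact K & range a `<=` K) /\
  (forall j, `|a j.+1 - alpha| <= lambda * `|a j - alpha|).

Fixpoint lacunary_set lambda (N : nat) : set (set R) :=
  if N is N'.+1 then
    [set U | precompact U /\
      exists a alpha, let A := range a in
        [/\ lacunary_seq lambda a alpha,
            U `&` `[sup A, +oo[ = set0,
            U `&` `]-oo, inf A] = set0 &
            forall b c, A b -> A c -> b < c -> `]b, c[ `&` A = set0 ->
              lacunary_set lambda N' (U `&` `[b, c[)]]
  else [set U | is_subset1 U].

Definition covered_by_lacunary lambda (N r : nat) : set (set R) :=
  [set S | exists F : 'I_r -> set R,
    (forall k, lacunary_set lambda N (F k)) /\ S `<=` \bigcup_k F k].

End Lacunary.

Section Euclidean.
Variables (R : realType) (n : nat).
Implicit Types (x y a : 'rV[R]_n) (V U : set 'rV[R]_n).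

(* The library norm on 'rV[R]_n is the sup norm, hence these definitions. *)
Definition dotp x y : R := \sum_i x ord0 i * y ord0 i.
Definition enorm x : R := Num.sqrt (dotp x x).

(* The rows of B are v_1, ..., v_d, so that a + x *m B is a + \sum_i x_i v_i;
   in particular V is a d-dimensional affine subspace containing a. *)
Definition orthonormal_frame d V a (B : 'M[R]_(d, n)) : Prop :=
  (forall i j, dotp (row i B) (row j B) = (i == j)%:R) /\
  V = [set a + x *m B | x in [set: 'rV[R]_d]].

(* pi_j(U) in the frame (a, B). *)
Definition coord_proj d a (B : 'M[R]_(d, n)) (j : 'I_d) U : set R :=
  [set x ord0 j | x in [set x : 'rV[R]_d | U (a + x *m B)]].

Definition lacunary_in d (N : nat) (lambda : R) (r : nat) V :
    set (set 'rV[R]_n) :=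
  [set U | [/\ U `<=` V, precompact U &
    forall a (B : 'M[R]_(d, n)), orthonormal_frame V a B ->
      forall j, covered_by_lacunary lambda N r (coord_proj a B j U)]].

Definition hyperplane V : Prop :=
  exists (nu : 'rV[R]_n) (c : R), nu != 0 /\ V = [set x | dotp nu x = c].

Definition dist_origin V : R := inf [set enorm x | x in V].

(* Lebesgue outer measure: covers by countably many closed boxes. Unions of
   tubes (nondegenerate convex sets) are Lebesgue measurable, so on them it is
   n-dimensional Lebesgue measure. *)
Definition box x y : set 'rV[R]_n :=
  [set z | forall i, x ord0 i <= z ord0 i <= y ord0 i].

Definition lebesgue_outer (E : set 'rV[R]_n) : \bar R :=
  ereal_inf [set s | exists x y : nat -> 'rV[R]_n,
    [/\ forall k i, x k ord0 i <= y k ord0 i,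
        E `<=` \bigcup_k box (x k) (y k) &
        s = (\sum_(0 <= k <oo) (\prod_i (y k ord0 i - x k ord0 i))%:E)%E]].

(* The axis vector is required to be a unit vector in is_tube. *)
Record tube := Tube {
  centre : 'rV[R]_n;
  axis : 'rV[R]_n;
  tlength : R;
  tradius : R
}.

Definition is_tube (P : tube) : Prop :=
  [/\ enorm (axis P) = 1, 0 < tlength P & 0 < tradius P].

Definition tube_set (P : tube) : set 'rV[R]_n :=
  [set x | let y := x - centre P in let t := dotp y (axis P) in
    `|t| <= tlength P / 2 /\ enorm (y - t *: axis P) <= tradius P].

Definition oriented (P : tube) (w : 'rV[R]_n) : Prop :=
  exists c : R, axis P = c *: w.

Definition dilate (A0 : R) (P : tube) : tube :=
  Tube (centre P) (axis P) (A0 * tlength P) (tradius P).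

End Euclidean.

Section DirectionSets.
Variables (R : realType) (d : nat).
Implicit Types Omega : set 'rV[R]_d.+1.

Definition cone Omega : set 'rV[R]_d.+1 :=
  [set x | exists r w, [/\ 0 < r, Omega w & x = r *: w]].

Definition admissible_lacunary Omega (N : nat) (lambda : R) : Prop :=
  exists2 r : nat, (1 <= r)%N &
    forall V, hyperplane V -> dist_origin V = 1 ->
    forall U, U `<=` cone Omega `&` V -> precompact U ->
      lacunary_in d N lambda r V U.

Definition sublacunary Omega : Prop :=
  forall (N : nat) (lambda : R), (1 <= N)%N -> 0 < lambda < 1 ->
    ~ admissible_lacunary Omega N lambda.

(* The measure of E N is required to be positive and finite so that the quotient
   is meaningful; the measure of Estar N may be infinite. *)
Definition admits_kakeya_type_sets Omega : Prop :=
  exists2 A0 : R, 1 <= A0 &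
  exists (delta : nat -> R) (P : nat -> set (tube R d.+1)),
    let E N := \bigcup_(T in P N) tube_set T in
    let Estar N := \bigcup_(T in P N) tube_set (dilate A0 T) in
    [/\ (forall N, (1 <= N)%N -> 0 < delta N < 1),
        (forall M N, (1 <= M <= N)%N -> delta N <= delta M) /\
          delta N @[N --> \oo] --> (0 : R),
        (forall N, (1 <= N)%N -> forall T, P N T ->
           [/\ is_tube T, exists2 w, Omega w & oriented T w,
               1 <= tlength T & tradius T <= delta N]),
        (forall N, (1 <= N)%N -> (0 < lebesgue_outer (E N) < +oo)%E) &
        (lebesgue_outer (Estar N) / lebesgue_outer (E N))%E @[N --> \oo]
          --> (+oo : \bar R)%E].

End DirectionSets.

(* Main.v *)
Require Import Defs.
From mathcomp Require Import all_boot all_order all_algebra.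
From mathcomp Require Import all_classical all_reals all_analysis.
From mathcomp Require Import measurable_realfun.
From mathcomp Require Import zify ring lra.
Set Implicit Arguments.
Unset Strict Implicit.
Unset Printing Implicit Defensive.
Import Order.TTheory GRing.Theory Num.Theory.
Import numFieldNormedType.Exports.
Local Open Scope classical_set_scope.
Local Open Scope ring_scope.

(** Kakeya-type sets from a sublacunary direction set, by reduction to the plane.

    Trees.  If a bounded set of reals is not covered by boundedly many lacunary
    sets of order n, it carries a binary tree of height n in which the gap between
    two siblings is as large as we like compared with the size of either
    ([lacunary_cover_of_no_tree]).  Contrapositively, without such a tree of height
    n + 1 the subsets carrying trees of height n cluster, at every scale, around
    one point ([tree_concentration]); cutting the set into dyadic annuli around that
    point leaves pieces without trees of height n, and pieces of the same rank in
    their annuli reassemble into a lacunary set of order n + 1.  Sublacunarity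
    therefore yields trees of all heights in coordinate projections of the
    direction set ([sublacunary_tree]).

    The plane.  Let S be a set of slopes with a tree of height N.  A family of
    lines y = s x + b, s in S, is built recursively: at a node with children t0, t1
    the intercepts are cut into stripes of width 2 (t1 - t0); alternate stripes
    carry the lines of the two children, and the stripes are shifted at random,
    independently at all nodes.  At abscissa x a point sees the stripes of both
    children with probability about x / 4, those of neither with the same
    probability, and otherwise those of exactly one.  The probability p_k(x) that
    the point lies on a line of the family of height k is thus the survival
    probability of a critical branching process, p_(k+1) = p_k - (x / 4) p_k ^ 2, so
    that p_N(x) is comparable with 1 / (1 + N x).  It is O(1 / N) for x in [1, 2],
    while its integral over [1 / N, 1] is of order log N / N ([sticky_family]).
    These are statements about each point separately, which is why the periods of
    different nodes may be incommensurable.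

    Space.  With an orthonormal frame whose first axis is normal to the hyperplane
    and one of whose other axes carries the slopes, take the tubes over x in [1, 2]
    around the lines whose chosen coordinate follows a line of the planar family,
    and whose other coordinates at x = 0 range over a cube that is large compared
    with their slopes.  The extra coordinates then contribute the same factor, up to
    a constant, to the union of the tubes and to the union of their threefold
    dilates, which reach back to x = 0; so the two volumes are in proportion to the
    planar ones ([tubes_cover], [tubes_contain_ball]).  Counting the grid points met
    and averaging over the random shifts ([exists_good_index]) gives one family of
    tubes whose dilates win by a factor of order log N ([kakeya_tubes_exist]).
    The grid is aligned with the frame and the measure is defined by boxes aligned
    with the standard axes; passing from grid counts to volumes therefore costs a
    constant that depends on the dimension, but not on N. *)

(** * Separated trees and lacunary covers *)

Section LacunaryCover.
Variable R : realType.
Implicit Types (S U : set R) (n q : nat).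

(** The common radius [delta] of the two children makes the gap dominate both sizes
    at once; for large [q] the children of a child are then much closer together
    than [t0] and [t1]. *)
Fixpoint separated_tree q n S : Prop :=
  if n is m.+1 then
    exists t0 t1 delta : R, [/\ 0 < delta, q%:R * delta < t1 - t0,
      separated_tree q m (S `&` `[t0 - delta, t0 + delta]) &
      separated_tree q m (S `&` `[t1 - delta, t1 + delta])]
  else S !=set0.

Lemma separated_treeS q n S U :
  S `<=` U -> separated_tree q n S -> separated_tree q n U.
Proof.
elim: n S U => [|n IHn] S U SU /=; first by move=> [x /SU ?]; exists x.
move=> [t0 [t1 [dl [dl0 t01 S0 S1]]]]; exists t0, t1, dl; split=> //.
  by apply: IHn S0; exact: setSI.
by apply: IHn S1; exact: setSI.
Qed.

Lemma precompact_sub_itv S (a b : R) : S `<=` `[a, b] -> precompact S.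
Proof.
move=> Sab; apply: precompact_subset Sab _.
by apply: compact_precompact; [exact: Rhausdorff|exact: segment_compact].
Qed.

Lemma lacunary_set_sub lambda n S U :
  S `<=` U -> lacunary_set lambda n U -> lacunary_set lambda n S.
Proof.
elim: n S U => [|n IHn] S U SU /=; first by move=> + x y Sx Sy; apply; exact: SU.
move=> [cU [a [al [la sA iA H]]]]; split; first exact: precompact_subset cU.
exists a, al; split => //.
- by apply/seteqP; split=> // x [/SU Ux xs]; rewrite -sA.
- by apply/seteqP; split=> // x [/SU Ux xs]; rewrite -iA.
- by move=> b c Ab Ac bc bcA; apply: IHn (H b c Ab Ac bc bcA); exact: setSI.
Qed.

(** Geometric sequences with ratio 1/2, descending ([s = 1]) or ascending
    ([s = -1]) to [al]. *)
Definition geom_seq (al s rho : R) (k : nat) : R := al + s * (rho * 2^-1 ^+ k).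

Lemma geom_lt (rho : R) (i j : nat) : 0 < rho ->
  (rho * 2^-1 ^+ i < rho * 2^-1 ^+ j) = (j < i)%N.
Proof.
by move=> rho0; rewrite ltr_pM2l// ltr_iXn2l// ?invr_gt0// invf_lt1// ltr1n.
Qed.

Lemma geom_le1 (rho : R) k : 0 < rho -> 0 < rho * 2^-1 ^+ k <= rho.
Proof.
move=> rho0; rewrite mulr_gt0/= ?exprn_gt0// ?invr_gt0//.
by rewrite ger_pMr// exprn_ile1// ?invr_ge0// invf_le1// ler1n.
Qed.

(** The geometric sequence itself serves as the lacunary sequence: being strictly
    monotone, its only gaps are those between successive terms. *)
Lemma lacunary_set_glue n U (al s rho : R) : 0 < rho -> s = 1 \/ s = -1 ->
  precompact U ->
  (forall x, U x -> exists i j,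
     geom_seq al s rho i < x /\ x < geom_seq al s rho j) ->
  (forall k b c, b = geom_seq al s rho k /\ c = geom_seq al s rho k.+1 \/
     c = geom_seq al s rho k /\ b = geom_seq al s rho k.+1 ->
     lacunary_set 2^-1 n (U `&` `[b, c[)) ->
  lacunary_set 2^-1 n.+1 U.
Proof.
move=> rho0 s1 cU btw H; set a := geom_seq al s rho.
have Na : range a `<=` `[al - rho, al + rho].
  move=> _ [k _ <-]; rewrite /a /geom_seq /= in_itv/=.
  by have := geom_le1 k rho0; case: s1 => ->; lra.
have ubA : has_ubound (range a).
  by exists (al + rho) => y /Na; rewrite /= in_itv/= => /andP[].
have lbA : has_lbound (range a).
  by exists (al - rho) => y /Na; rewrite /= in_itv/= => /andP[].
split=> //; exists a, al; split => //.
- split; first by exists [set` `[al - rho, al + rho]%R] => //; exact: segment_compact.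
  move=> j; rewrite /a /geom_seq.
  have cK t : al + t - al = t by ring.
  rewrite !cK; have -> : s * (rho * 2^-1 ^+ j.+1) = 2^-1 * (s * (rho * 2^-1 ^+ j)).
    by rewrite exprS; ring.
  by rewrite normrM ger0_norm ?invr_ge0.
- apply/seteqP; split=> // x [/btw[i [j [_ xj]]]]; rewrite /= in_itv/= andbT.
  by rewrite leNgt => /negP; apply; apply: lt_le_trans xj _; apply: ub_le_sup => //; exists j.
- apply/seteqP; split=> // x [/btw[i [j [xi _]]]]; rewrite /= in_itv/=.
  by rewrite leNgt => /negP; apply; apply: le_lt_trans xi; apply: ge_inf => //; exists i.
move=> _ _ [i _ <-] [j _ <-] ij0 ij1.
have Nb k : ~ (a i < a k < a j).
  move=> h; have : (`]a i, a j[ `&` range a) (a k) by split => //; exists k.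
  by rewrite ij1.
have aS : forall x y, (a x < a y) = if s == 1 then (y < x)%N else (x < y)%N.
  move=> x y; rewrite /a /geom_seq; case: s1 => ->.
    by rewrite eqxx !mul1r ltrD2l geom_lt.
  rewrite ifF; last by apply/negP => /eqP; lra.
  by rewrite ltrD2l !mulN1r ltrN2 geom_lt.
move: ij0; rewrite aS; case: ifP => sE ij0.
  have := Nb j.+1; rewrite !aS sE ltnSn andbT => /negP; rewrite -leqNgt => ji.
  apply: (H j); right; split=> //; congr (geom_seq _ _ _ _); lia.
have := Nb i.+1; rewrite !aS sE ltnSn /= => /negP; rewrite -leqNgt => ji.
apply: (H i); left; split=> //; congr (geom_seq _ _ _ _); lia.
Qed.

(** The centre of the annuli belongs to none of them, and has to be covered
    separately. *)
Lemma lacunary_set_singleton n (x : R) : lacunary_set 2^-1 n [set x].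
Proof.
elim: n => [y z -> ->//|n IHn].
apply: (@lacunary_set_glue n [set x] (x - 2^-1) 1 2) => //; first by left.
- by apply: (@precompact_sub_itv _ x x) => _ ->; rewrite /= in_itv/= lexx.
- by move=> _ ->; exists 3, 0; rewrite /geom_seq !exprS expr0; split; lra.
- by move=> k b c _; apply: lacunary_set_sub IHn => y [].
Qed.


Lemma covered_by_finType lambda n (T : finType) (F : T -> set R) S :
  (forall t, lacunary_set lambda n (F t)) ->
  (forall x, S x -> exists t, F t x) ->
  covered_by_lacunary lambda n #|T| S.
Proof.
move=> HF HS; exists (F \o enum_val); split => [k|x /HS[t Ftx]]; first exact: HF.
by exists (enum_rank t) => //=; rewrite enum_rankK.
Qed.

(** Two versions because a lacunary set is cut into intervals closed on the left,
    which are annuli closed at the inner end to the right of the centre and at the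
    outer end to its left. *)
Lemma dyadic_annulus (rho y : R) : 0 < rho -> 0 < y < rho ->
  (exists k, rho * 2^-1 ^+ k.+1 <= y /\ y < rho * 2^-1 ^+ k) /\
  (exists k, rho * 2^-1 ^+ k.+1 < y /\ y <= rho * 2^-1 ^+ k).
Proof.
move=> rho0 /andP[y0 yrho].
have ex : exists k, rho * 2^-1 ^+ k.+1 < y.
  exists (Num.bound (rho / y)); rewrite exprVn ltr_pdivrMr ?exprn_gt0//.
  rewrite mulrC -ltr_pdivrMr//.
  by apply: lt_trans (upper_nthrootP (leqnn _)) _; rewrite exprS ltr_pMl ?exprn_gt0// ltr1n.
have ex' : exists k, rho * 2^-1 ^+ k.+1 <= y by case: ex => k /ltW; exists k.
split; [case: (ex_minnP ex')|case: (ex_minnP ex)] => -[|k] kP kmin;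
  [exists 0%N|exists k.+1|exists 0%N|exists k.+1]; split=> //.
- by rewrite expr0 mulr1.
- by rewrite ltNge; apply/negP => /kmin; rewrite ltnn.
- by rewrite expr0 mulr1 ltW.
- by rewrite leNgt; apply/negP => /kmin; rewrite ltnn.
Qed.

Lemma subdivide_itv q (lo L x : R) : (0 < q)%N -> 0 < L -> lo <= x < lo + L ->
  exists i : 'I_q, lo + i%:R * (L / q%:R) <= x <= lo + i%:R * (L / q%:R) + L / q%:R.
Proof.
move=> q0 L0 /andP[lox xL].
have w0 : 0 < L / q%:R by rewrite divr_gt0// ltr0n.
have y0 : 0 <= (x - lo) / (L / q%:R) by rewrite divr_ge0 ?subr_ge0// ltW.
have := truncn_itv y0; set i := Num.trunc _ => /andP[].
rewrite ler_pdivlMr// ltr_pdivrMr// => i1 i2.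
have iq : (i < q)%N.
  rewrite -(ltr_nat R) -(ltr_pM2r w0); apply: le_lt_trans i1 _.
  by rewrite mulrCA divff ?mulr1 ?pnatr_eq0 -?lt0n//; lra.
exists (Ordinal iq) => /=; move: i2; rewrite -[i.+1]addn1 natrD mulrDl mul1r; lra.
Qed.

(** Two far apart intervals of a common size cannot both carry trees of height n,
    so all of those that do, at every scale, surround a single point. *)
Lemma tree_concentration q n S : ~ separated_tree q n.+1 S ->
  exists al : R, forall t delta, 0 < delta ->
    separated_tree q n (S `&` `[t - delta, t + delta]) ->
    `|t - al| <= q%:R * delta.
Proof.
move=> noT.
pose tr (t delta : R) := 0 < delta /\ separated_tree q n (S `&` `[t - delta, t + delta]).
pose E := [set z | exists t delta, tr t delta /\ z = t - q%:R * delta].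
have cmp t dl t' dl' : tr t dl -> tr t' dl' -> t - q%:R * dl <= t' + q%:R * dl'.
  move=> [dl0 T1] [dl0' T2]; rewrite leNgt; apply/negP => lt.
  have q0 : 0 <= q%:R :> R by [].
  apply: noT; pose D := Num.max dl dl'.
  have [D1 D2] : dl <= D /\ dl' <= D by rewrite !le_max !lexx orbT.
  (* Both trees live in intervals of the larger radius. *)
  exists t', t, D; split.
  - by rewrite lt_max dl0.
  - by rewrite /D /Num.max; case: ifP => _; nra.
  - apply: separated_treeS T2; apply: setIS => x; rewrite /= !in_itv/=; lra.
  - apply: separated_treeS T1; apply: setIS => x; rewrite /= !in_itv/=; lra.
exists (sup E) => t dl dl0 T.
have ubE : has_ubound E.
  by exists (t + q%:R * dl) => _ [t' [dl' [T' ->]]]; apply: cmp.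
have : t - q%:R * dl <= sup E by apply: ub_le_sup => //; exists t, dl.
have : sup E <= t + q%:R * dl.
  apply: ge_sup; first by exists (t - q%:R * dl), t, dl.
  by move=> _ [t' [dl' [T' ->]]]; apply: cmp.
by rewrite ler_norml; lra.
Qed.

(** Every dyadic annulus around the point of concentration is cut into [q] pieces,
    each too small for its distance to that point to carry a tree of height [n].
    By induction each piece is covered by [r] lacunary sets; those with the same
    side, position and index, one in each annulus, are glued together. *)
Lemma lacunary_cover_of_no_tree q n : (0 < q)%N -> exists2 r, (0 < r)%N &
  forall S (a b : R), S `<=` `[a, b] -> ~ separated_tree q n S ->
    covered_by_lacunary 2^-1 n r S.
Proof.
move=> q0; elim: n => [|n [r r0 IHn]].
  exists 1%N => // S a b _ noT; exists (fun=> set0); split; first by move=> k x y.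
  by move=> x Sx; exfalso; apply: noT; exists x.
pose T := option ((bool * 'I_q) * 'I_r).
exists #|{: T}|; first by rewrite card_option.
move=> S a b Sab noT.
have [al alP] := tree_concentration noT.
pose rho : R := `|a - al| + `|b - al| + 1.
have rho0 : 0 < rho by rewrite /rho; have := normr_ge0 (a - al); have := normr_ge0 (b - al); lra.
have Sal x : S x -> al - rho < x < al + rho.
  move=> /Sab; rewrite /= in_itv/= /rho => /andP[ax xb].
  have := ler_norm (b - al); have := ler_norm (al - a); rewrite (distrC al).
  have := normr_ge0 (a - al); have := normr_ge0 (b - al); lra.
pose ro k : R := rho * 2^-1 ^+ k.
have ro0 k : 0 < ro k by rewrite mulr_gt0// exprn_gt0// invr_gt0.
have roS k : ro k = 2 * ro k.+1 by rewrite /ro exprS; field.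
have ro_lt i j : (ro i < ro j) = (j < i)%N by exact: geom_lt.
have ro_le i j : (ro i <= ro j) = (j <= i)%N by rewrite leNgt ro_lt -leqNgt.
pose sgn (s : bool) : R := if s then 1 else -1.
pose lo s k := if s then al + ro k.+1 else al - ro k.
pose hi s k := if s then al + ro k else al - ro k.+1.
have hilo s k : hi s k = lo s k + ro k.+1.
  by rewrite /hi /lo (roS k); case: s; ring.
pose dl k := ro k.+1 / q%:R / 2.
pose t s k (i : 'I_q) := lo s k + i%:R * (ro k.+1 / q%:R) + dl k.
pose ball s k i : set R := [set` `[t s k i - dl k, t s k i + dl k]%R].
have qR : 0 < q%:R :> R by rewrite ltr0n.
(* The distance of the annulus to [al] is its own length, hence exceeds q times the
   radius of a piece. *)
have noTk s k i : ~ separated_tree q n (S `&` ball s k i).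
  have w0 : 0 < ro k.+1 / q%:R by rewrite divr_gt0.
  have dl0 : 0 < dl k by rewrite divr_gt0.
  have qdl : q%:R * dl k = ro k.+1 / 2 by rewrite /dl; field; rewrite gt_eqF.
  have i0 : 0 <= i%:R :> R by [].
  have iq : i%:R * (ro k.+1 / q%:R) + ro k.+1 / q%:R <= ro k.+1.
    rewrite -{2}[ro k.+1 / q%:R]mul1r -mulrDl mulrCA ger_pMr// ler_pdivrMr// mul1r.
    by rewrite natr1 ler_nat.
  have idl : dl k = ro k.+1 / q%:R / 2 by [].
  move=> /(alP _ _ dl0); rewrite leNgt qdl => /negP; apply.
  have wi : 0 <= i%:R * (ro k.+1 / q%:R) by rewrite mulr_ge0// ltW.
  have rk := ro0 k.+1; rewrite /t /lo; case: s.
    apply: lt_le_trans (ler_norm _); lra.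
  rewrite -normrN; apply: lt_le_trans (ler_norm _); rewrite (roS k); lra.
have /choice[G GP] : forall p : bool * nat * 'I_q, exists F : 'I_r -> set R,
    (forall j, lacunary_set 2^-1 n (F j)) /\
    S `&` ball p.1.1 p.1.2 p.2 `<=` \bigcup_j F j.
  move=> [[s k] i] /=; apply: (IHn _ (t s k i - dl k) (t s k i + dl k)).
    by move=> x [].
  exact: noTk.
pose ann s k : set R := [set` `[lo s k, hi s k[%R].
have ann_inj s k k' x : ann s k x -> ann s k' x -> k = k'.
  rewrite /ann /= !in_itv/= /lo /hi; case: s => /andP[h1 h2] /andP[h3 h4].
    have : ro k.+1 < ro k' by lra.
    have : ro k'.+1 < ro k by lra.
    by rewrite !ro_lt; lia.
  have : ro k'.+1 < ro k by lra.
  have : ro k.+1 < ro k' by lra.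
  by rewrite !ro_lt; lia.
pose F (p : T) : set R := if p is Some ((s, i), j) then
   S `&` \bigcup_k (G (s, k, i) j `&` ann s k) else [set al].
apply: (@covered_by_finType _ _ _ F).
  move=> [[[s i] j]|]; last exact: lacunary_set_singleton.
  apply: (@lacunary_set_glue _ _ al (sgn s) rho) => //.
  - by case: s; [left|right].
  - by apply: (@precompact_sub_itv _ a b) => x [] /Sab.
  - move=> x [Sx [k _ [_]]]; rewrite /ann /lo /hi /geom_seq /sgn /= in_itv/=.
    case: s => /andP[h1 h2].
      have := roS k; have := roS k.+1; have := ro0 k.+2.
      by exists k.+2, k; rewrite -!/(ro _); split; lra.
    case: k h1 h2 => [|k] h1 h2.
      have := roS 0%N; have := roS 1%N; have := ro0 2%N.
      exists 0%N, 1%N; rewrite -!/(ro _); split; last lra.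
      by have := Sal _ Sx; rewrite /ro expr0 mulr1; lra.
    exists k, k.+2; rewrite -!/(ro _); split; last lra.
    by have := ro0 k; have := roS k; lra.
  - move=> k b' c' bc; apply: lacunary_set_sub ((GP (s, k, i)).1 j) => x.
    move=> [[Sx [k' _ [Gx annx]]]]; rewrite /= in_itv/= => /andP[xb xc].
    suff /(ann_inj _ _ _ _ annx) <- : ann s k x by [].
    move: bc xb xc; rewrite /ann /lo /hi /geom_seq /sgn /= in_itv/= -!/(ro _).
    have := roS k; have := ro0 k.+1.
    by case: s {annx Gx} => ? ? [] [-> ->]; lra.
move=> x Sx.
have cover s k : ann s k x -> exists p, F p x.
  move=> annx; have xlo : lo s k <= x < lo s k + ro k.+1.
    by rewrite -hilo; move: annx; rewrite /ann /= in_itv.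
  have [i xi] := subdivide_itv q0 (ro0 _) xlo.
  have [|j _ Gx] := (GP (s, k, i)).2 x.
    split=> //=; rewrite /ball/= in_itv/= /t /dl; move: xi.
    by set w := ro _ / _; lra.
  by exists (Some ((s, i), j)); split => //; exists k.
have := Sal _ Sx => /andP[x1 x2].
case: (ltgtP x al) => [xal|xal|->]; last by exists None.
  have [|_ [k [k1 k2]]] := @dyadic_annulus rho (al - x) rho0; first lra.
  by apply: (cover false k); rewrite /ann /lo /hi /= in_itv/= -!/(ro _) in k1 k2 *; lra.
have [|[k [k1 k2]] _] := @dyadic_annulus rho (x - al) rho0; first lra.
by apply: (cover true k); rewrite /ann /lo /hi /= in_itv/= -!/(ro _) in k1 k2 *; lra.
Qed.

End LacunaryCover.

(** * Outer measure and disjoint or covering cubes *)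

Section BoxMeasure.
Variable R : realType.

Lemma integral_indic_itv (c a b : R) : 0 <= c -> a <= b ->
  (\int[lebesgue_measure]_(t in setT) (c * \1_`[a, b] t)%:E = (c * (b - a))%:E)%E.
Proof.
move=> c0 ab.
under eq_integral do rewrite EFinM.
rewrite ge0_integralZl//=; last by apply/measurable_EFinP; exact: measurable_indic.
rewrite integral_indic// setIT [X in (_ * X)%E](lebesgue_measure_itv `[a, b])/= lte_fin.
by move: ab; rewrite le_eqVlt => /predU1P[->|->]; rewrite ?ltxx ?subrr ?mulr0 ?mule0.
Qed.

Lemma interval_sum_le m (c l u e x y : nat -> R) :
  (forall k, 0 <= c k) -> (forall k, 0 <= e k) ->
  (forall k, l k <= u k) -> (forall k, x k <= y k) ->
  (forall t, ((\sum_(k < m) c k * \1_`[l k, u k] t)%:E <=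
     \sum_(0 <= k <oo) (e k * \1_`[x k, y k] t)%:E)%E) ->
  ((\sum_(k < m) c k * (u k - l k))%:E <=
     \sum_(0 <= k <oo) (e k * (y k - x k))%:E)%E.
Proof.
move=> c0 e0 lu xy H.
have mI (f a b : nat -> R) k :
    measurable_fun [set: R] (fun t => (f k * \1_`[a k, b k] t)%:E).
  by apply/measurable_EFinP; apply: measurable_funM => //; exact: measurable_indic.
have pI (f a b : nat -> R) : (forall k, 0 <= f k) -> forall k t,
    (0 <= (f k * \1_`[a k, b k] t)%:E)%E.
  by move=> f0 k t; rewrite lee_fin mulr_ge0.
rewrite -sumEFin.
under eq_bigr do rewrite -integral_indic_itv//.
rewrite -ge0_integral_sum//=; [|by move=> k; exact: mI|by move=> k t _; exact: pI].
under eq_eseriesr do rewrite -integral_indic_itv//.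
rewrite -integral_nneseries//=; [|by move=> k; exact: mI|by move=> k t _; exact: pI].
apply: ge0_le_integral => //=.
- by move=> t _; apply: sume_ge0 => k _; exact: pI.
- by apply: emeasurable_sum => k; exact: mI.
- by apply: ge0_emeasurable_sum => [k t _ _|k _]; [exact: pI|exact: mI].
- by move=> t _; rewrite sumEFin; exact: H.
Qed.

(** Monotonicity of volume for weighted sums of boxes, by integrating one coordinate
    at a time.  The weights are what lets the induction on the dimension go
    through: fixing the last coordinate turns indicator values into weights. *)
Lemma box_sum_le n m (c e : nat -> R) (l u x y : nat -> nat -> R) :
  (forall k, 0 <= c k) -> (forall k, 0 <= e k) ->
  (forall k i, l k i <= u k i) -> (forall k i, x k i <= y k i) ->
  (forall z : nat -> R,
    ((\sum_(k < m) c k * \prod_(i < n) \1_`[l k i, u k i] (z i))%:E <=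
     \sum_(0 <= k <oo) (e k * \prod_(i < n) \1_`[x k i, y k i] (z i))%:E)%E) ->
  ((\sum_(k < m) c k * \prod_(i < n) (u k i - l k i))%:E <=
     \sum_(0 <= k <oo) (e k * \prod_(i < n) (y k i - x k i))%:E)%E.
Proof.
elim: n c e => [|n IHn] c e c0 e0 lu xy H.
  have := H (fun=> 0).
  under eq_bigr do rewrite big_ord0.
  under [X in (_ <= X -> _)%E]eq_eseriesr do rewrite big_ord0.
  under [in X in _ -> X]eq_bigr do rewrite big_ord0.
  by under [X in (_ -> _ <= X)%E]eq_eseriesr do rewrite big_ord0.
under eq_bigr do rewrite big_ord_recr/= mulrA.
under eq_eseriesr do rewrite big_ord_recr/= mulrA.
apply: (@interval_sum_le m (fun k => c k * \prod_(i < n) (u k i - l k i))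
   (l^~ n) (u^~ n) (fun k => e k * \prod_(i < n) (y k i - x k i)) (x^~ n) (y^~ n)) => // [k|k|t].
- by rewrite mulr_ge0// prodr_ge0// => i _; rewrite subr_ge0.
- by rewrite mulr_ge0// prodr_ge0// => i _; rewrite subr_ge0.
under eq_bigr do rewrite mulrAC.
under eq_eseriesr do rewrite mulrAC.
apply: (IHn (fun k => c k * \1_`[l k n, u k n] t)
  (fun k => e k * \1_`[x k n, y k n] t)) => // [k|k|z]; [by rewrite mulr_ge0| by rewrite mulr_ge0|].
have := H (fun i => if i == n then t else z i).
have E (b : nat -> R) (a a' : nat -> nat -> R) k :
  b k * \prod_(i < n.+1) \1_`[a k i, a' k i] (if i == n :> nat then t else z i) =
  b k * \1_`[a k n, a' k n] t * \prod_(i < n) \1_`[a k i, a' k i] (z i) :> R.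
  rewrite big_ord_recr/= eqxx -[in RHS]mulrA [in RHS](mulrC (\1_ _ t)).
  by under eq_bigr do rewrite (ltn_eqF (ltn_ord _)).
under eq_bigr do rewrite E.
by under eq_eseriesr do rewrite E.
Qed.

(** Coordinates indexed by all of [nat], so that one induction can change the
    dimension. *)
Definition natrow n (v : 'rV[R]_n) (i : nat) : R :=
  if insub i is Some j then v ord0 j else 0.

Lemma natrowE n (v : 'rV[R]_n) (i : 'I_n) : natrow v i = v ord0 i.
Proof. by rewrite /natrow valK. Qed.

Lemma indic_boxE n (v w : 'rV[R]_n) (z : nat -> R) :
  \prod_(i < n) \1_`[natrow v i, natrow w i] (z i) =
  \1_(box v w) (\row_(i < n) z i) :> R.
Proof.
rewrite [RHS]indicE; case: (boolP (_ \in box v w)) => [|].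
  rewrite inE => h; rewrite big1// => i _; rewrite indicE mem_set//=.
  by rewrite in_itv/= !natrowE; have := h i; rewrite mxE.
move/negP; rewrite inE/= => /existsNP[i hi].
rewrite (bigD1 i)//= indicE memNset ?mul0r//= => hz; apply: hi.
by rewrite mxE; move: hz; rewrite in_itv/= !natrowE.
Qed.

Lemma outer_le_boxes n (T : finType) (P : pred T) (f : T -> 'rV[R]_n.+1)
    (r : R) (E : set 'rV[R]_n.+1) : 0 <= r ->
  (forall z, E z -> exists2 g, P g & forall i, `|z ord0 i - f g ord0 i| <= r) ->
  (lebesgue_outer E <= (#|P|%:R * (2 * r) ^+ n.+1)%:E)%E.
Proof.
move=> r0 cover.
pose c (k : nat) := if insub k is Some j then f (@enum_val T P j) else 0.
pose h (k : nat) := if (k < #|P|)%N then r else 0.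
pose x k := c k - const_mx (h k); pose y k := c k + const_mx (h k).
apply: ereal_inf_lbound; exists x, y; split.
- move=> k i; rewrite !mxE /h; case: ifP => _; lra.
- move=> z /cover[g Pg zg]; exists (enum_rank_in Pg g) => //= i.
  rewrite !mxE /c /h ltn_ord valK enum_rankK_in//.
  by have := zg i; rewrite ler_distl.
have vol k : \prod_i (y k ord0 i - x k ord0 i) = (2 * h k) ^+ n.+1.
  rewrite -[in RHS](card_ord n.+1) -prodr_const; apply: eq_bigr => i _.
  by rewrite !mxE; ring.
under eq_eseriesr do rewrite vol.
rewrite (nneseries_split 0 #|P|); last first.
  by move=> k _; rewrite lee_fin exprn_ge0// mulr_ge0// /h; case: ifP.
rewrite eseries0 ?adde0; last first.
  by move=> k; rewrite add0n => Pk _; rewrite /h ltnNge Pk/= mulr0 expr0n.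
rewrite add0n big_mkord sumEFin; congr _%:E.
under eq_bigr do rewrite /h ltn_ord.
by rewrite sumr_const card_ord mulr_natl.
Qed.

(** Disjoint cubes inside [E] have total volume at most that of any cover of [E],
    because the indicators compare pointwise. *)
Lemma outer_ge_boxes n (T : finType) (P : pred T) (f : T -> 'rV[R]_n)
    (r : R) (E : set 'rV[R]_n) : 0 <= r ->
  (forall g g', P g -> P g' -> g != g' ->
     exists i, 2 * r < `|f g ord0 i - f g' ord0 i|) ->
  (forall g (z : 'rV[R]_n), P g -> (forall i, `|z ord0 i - f g ord0 i| <= r) -> E z) ->
  ((#|P|%:R * (2 * r) ^+ n)%:E <= lebesgue_outer E)%E.
Proof.
move=> r0 sep sub; apply/ereal_infP => _ [x [y [xy cover ->]]].
pose c (k : nat) := if insub k is Some j then f (@enum_val T P j) else 0.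
have cE (k : 'I_#|P|) : c k = f (enum_val k) by rewrite /c valK.
pose l k := c k - const_mx r; pose u k := c k + const_mx r.
have boxP (k : 'I_#|P|) z : box (l k) (u k) z ->
    forall i, `|z ord0 i - f (enum_val k) ord0 i| <= r.
  by move=> h i; have := h i; rewrite !mxE cE ler_distl.
have := @box_sum_le n #|P| (fun=> 1) (fun=> 1) (fun k => natrow (l k))
  (fun k => natrow (u k)) (fun k => natrow (x k)) (fun k => natrow (y k)).
have E1 k : 1 * \prod_(i < n) (natrow (u k) i - natrow (l k) i) = (2 * r) ^+ n.
  rewrite mul1r -[in RHS](card_ord n) -prodr_const; apply: eq_bigr => i _.
  by rewrite !natrowE !mxE; ring.
have E2 k : 1 * \prod_(i < n) (natrow (y k) i - natrow (x k) i) =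
    \prod_(i < n) (y k ord0 i - x k ord0 i).
  by rewrite mul1r; under eq_bigr do rewrite !natrowE.
under [X in _ -> _ -> _ -> _ -> _ -> (X%:E <= _)%E]eq_bigr do rewrite E1.
under [X in _ -> _ -> _ -> _ -> _ -> (_ <= X)%E]eq_eseriesr do rewrite E2.
rewrite sumr_const card_ord [in X in _ -> X]mulr_natl; apply => //.
- move=> k i; rewrite /natrow; case: insubP => // j _ _; rewrite !mxE; lra.
- by move=> k i; rewrite /natrow; case: insubP.
move=> z.
under eq_bigr do rewrite mul1r indic_boxE.
under eq_eseriesr do rewrite mul1r indic_boxE.
set zv := \row_(i < n) z i.
have [[k0 zk0]|none] := pselect (exists k : 'I_#|P|, box (l k) (u k) zv); last first.
  rewrite big1; first by apply: nneseries_ge0 => k _ _; rewrite lee_fin.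
  move=> k _; rewrite indicE memNset// => zk; apply: none; by exists k.
have -> : \sum_(k < #|P|) \1_(box (l k) (u k)) zv = 1 :> R.
  rewrite (bigD1 k0)//= indicE mem_set// big1 ?addr0// => k kk0.
  rewrite indicE memNset// => zk.
  have [|i] := sep _ _ (enum_valP k) (enum_valP k0).
    by apply: contra kk0 => /eqP/enum_val_inj->.
  have := boxP _ _ zk i; have := boxP _ _ zk0 i.
  by rewrite !ler_norml ltNge ler_norml => /andP[? ?] /andP[? ?]; lra.
have /cover[k _ zk] : E zv by apply: (sub (enum_val k0)) (boxP _ _ zk0); exact: enum_valP.
apply: le_trans (nneseries_lim_ge k.+1 _); last by move=> ? _; rewrite lee_fin.
rewrite big_mkord (bigD1 ord_max)//= indicE mem_set//.
by rewrite leeDl// sume_ge0// => ? _; rewrite lee_fin.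
Qed.

End BoxMeasure.

(** * Counting random stripes *)

Section PhaseCount.
Variable h : nat.
Hypothesis h1 : (2 < h)%N.

(** Stripes on the integers: period [2 * h], of which the first half belongs to one
    child and the second half to the other. *)
Definition phase (c : int) : bool := ((c %% (2 * h)%:Z)%Z < h%:Z)%R.

Lemma phase_period c : phase (c + (2 * h)%:Z) = phase c.
Proof. by rewrite /phase modzDr. Qed.

Lemma phase_small (c : int) : - (2 * h)%:Z <= c < 2 * (2 * h)%:Z ->
  phase c = (c < h%:Z - (2 * h)%:Z) || (0 <= c < h%:Z) ||
    ((2 * h)%:Z <= c < (2 * h)%:Z + h%:Z).
Proof.
move=> hc; rewrite /phase.
have [c0|c0] := ltP c 0.
  rewrite -modzDr modz_small; lia.
have [c2|c2] := ltP c (2 * h)%:Z.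
  rewrite modz_small; lia.
rewrite -[c](subrK (2 * h)%:Z) modzDr modz_small; lia.
Qed.

(** A uniformly random shift makes the position in the period uniform, whatever the
    starting point. *)
Lemma sum_periodic (q : nat) (P : int -> nat) (c : int) :
  (forall z, P (z + q%:Z) = P z) ->
  (\sum_(j < q) P (c - j%:Z)%R = \sum_(k < q) P k%:Z)%N.
Proof.
case: q => [|q] per; first by rewrite !big_ord0.
have shift z : (\sum_(j < q.+1) P (z + 1 - j%:Z)%R = \sum_(j < q.+1) P (z - j%:Z)%R)%N.
  rewrite big_ord_recl [RHS]big_ord_recr /= addnC; congr (_ + _)%N.
    by apply: eq_bigr => i _; congr P; rewrite /bump/=; lia.
  by rewrite -[RHS]per; congr P; lia.
have {shift}cst z : (\sum_(j < q.+1) P (z - j%:Z)%R = \sum_(j < q.+1) P (0 - j%:Z)%R)%N.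
  elim/int_rect: z => // n IH.
    by rewrite -[n.+1]addn1 PoszD shift.
  by rewrite -IH -[in RHS](subrK 1 (- n%:Z)) shift; under eq_bigr do rewrite -[n.+1]addn1 PoszD opprD.
rewrite cst -(cst q%:Z) (reindex_inj rev_ord_inj)/=.
by apply: eq_bigr => i _; congr P; have := ltn_ord i; lia.
Qed.

Lemma sum_lt_ord q m : (m <= q)%N -> (\sum_(k < q) (k < m) = m)%N.
Proof.
have H : (\sum_(k < q) (k < m) = minn m q)%N.
  by elim: q => [|q IH]; rewrite ?big_ord0 ?big_ord_recr/= ?IH; lia.
by move=> mq; rewrite H; lia.
Qed.

Lemma sum_eq_ord q m : (\sum_(k < q) (k == m :> nat) <= 1)%N.
Proof.
have H : (\sum_(k < q) (k == m :> nat) = (m < q))%N.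
  by elim: q => [|q IH]; rewrite ?big_ord0 ?big_ord_recr/= ?IH//; lia.
by rewrite H; case: (_ < _)%N.
Qed.

(** The neighbours [c - 1] and [c + 1] absorb the spread of the slopes within one
    child, which moves a point by at most one unit of the discretised period. *)
Lemma count_phase_some (c : int) :
  (\sum_(j < 2 * h) [|| phase (c - 1 - j%:Z)%R, phase (c - j%:Z)%R | phase (c + 1 - j%:Z)%R]
     <= h + 2)%N.
Proof.
pose P z : nat := [|| phase (z - 1), phase z | phase (z + 1)].
rewrite (eq_bigr (fun j : 'I__ => P (c - j%:Z)%R)); last first.
  by move=> j _; rewrite /P !(addrAC c (- j%:Z)).
rewrite sum_periodic => [|z]; last first.
  by rewrite /P !(addrAC z (2 * h)%:Z) !phase_period.
have := sum_lt_ord (leq_pmull h (isT : 0 < 2)%N).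
have := sum_eq_ord (2 * h) h; have := sum_eq_ord (2 * h) (2 * h).-1.
have : (\sum_(k < 2 * h) P k%:Z <= \sum_(k < 2 * h) (k < h) +
   \sum_(k < 2 * h) (k == h :> nat) + \sum_(k < 2 * h) (k == (2 * h).-1 :> nat))%N.
  rewrite -!big_split/=; apply: leq_sum => k _; have kq := ltn_ord k.
  rewrite /P !phase_small; lia.
by lia.
Qed.

Lemma count_phase_all (c : int) :
  (h - 2 <= \sum_(j < 2 * h)
     [&& phase (c - 1 - j%:Z)%R, phase (c - j%:Z)%R & phase (c + 1 - j%:Z)%R])%N.
Proof.
pose P z : nat := [&& phase (z - 1), phase z & phase (z + 1)].
rewrite (eq_bigr (fun j : 'I__ => P (c - j%:Z)%R)); last first.
  by move=> j _; rewrite /P !(addrAC c (- j%:Z)).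
rewrite sum_periodic => [|z]; last first.
  by rewrite /P !(addrAC z (2 * h)%:Z) !phase_period.
have := sum_lt_ord (leq_pmull h (isT : 0 < 2)%N).
have := sum_eq_ord (2 * h) 0; have := sum_eq_ord (2 * h) h.-1.
have : (\sum_(k < 2 * h) (k < h) <= \sum_(k < 2 * h) P k%:Z +
   \sum_(k < 2 * h) (k == 0 :> nat) + \sum_(k < 2 * h) (k == h.-1 :> nat))%N.
  rewrite -!big_split/=; apply: leq_sum => k _; have kq := ltn_ord k.
  rewrite /P !phase_small; lia.
by lia.
Qed.

(** Points at distance [D] lie in the stripes of both children for [D] of the
    [2 * h] shifts: this is the second moment that drives the branching process. *)
Lemma count_phase_switch (c : int) (D : nat) : (D <= h)%N ->
  (\sum_(j < 2 * h) (phase (c - j%:Z)%R && ~~ phase (c - D%:Z - j%:Z)%R) = D)%N.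
Proof.
move=> Dh; pose P z : nat := phase z && ~~ phase (z - D%:Z).
rewrite (eq_bigr (fun j : 'I__ => P (c - j%:Z)%R)); last first.
  by move=> j _; rewrite /P !(addrAC c (- j%:Z)).
rewrite sum_periodic => [|z]; last first.
  by rewrite /P !(addrAC z (2 * h)%:Z) !phase_period.
rewrite -[RHS](@sum_lt_ord (2 * h)); last lia.
by apply: eq_bigr => k _; have kq := ltn_ord k; rewrite /P !phase_small; lia.
Qed.

Lemma count_not_phase_some (c : int) :
  (\sum_(j < 2 * h) [|| ~~ phase (c - 1 - j%:Z)%R, ~~ phase (c - j%:Z)%R |
     ~~ phase (c + 1 - j%:Z)%R] <= h + 2)%N.
Proof.
have := count_phase_all c.
suff : (\sum_(j < 2 * h) [|| ~~ phase (c - 1 - j%:Z)%R, ~~ phase (c - j%:Z)%R |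
     ~~ phase (c + 1 - j%:Z)%R] + \sum_(j < 2 * h)
     [&& phase (c - 1 - j%:Z)%R, phase (c - j%:Z)%R & phase (c + 1 - j%:Z)%R] = 2 * h)%N.
  by lia.
rewrite -big_split/= -[RHS]card_ord -sum1_card; apply: eq_bigr => j _.
by rewrite -!negb_and; case: (_ && _).
Qed.

Lemma count_not_phase_all (c : int) :
  (h - 2 <= \sum_(j < 2 * h) [&& ~~ phase (c - 1 - j%:Z)%R, ~~ phase (c - j%:Z)%R &
     ~~ phase (c + 1 - j%:Z)%R])%N.
Proof.
have := count_phase_some c.
suff : (\sum_(j < 2 * h) [&& ~~ phase (c - 1 - j%:Z)%R, ~~ phase (c - j%:Z)%R &
     ~~ phase (c + 1 - j%:Z)%R] + \sum_(j < 2 * h)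
     [|| phase (c - 1 - j%:Z)%R, phase (c - j%:Z)%R | phase (c + 1 - j%:Z)%R] = 2 * h)%N.
  by lia.
rewrite -big_split/= -[RHS]card_ord -sum1_card; apply: eq_bigr => j _.
by rewrite -!negb_or; case: (_ || _).
Qed.

End PhaseCount.


(** * One step of the branching process *)

Section Branching.
Variables (R : realFieldType) (I0 I1 J : finType).

Lemma sum_prod3 (f : I0 -> R) (g : I1 -> R) (h : J -> R) :
  \sum_(p : I0 * I1 * J) f p.1.1 * g p.1.2 * h p.2 =
  (\sum_i f i) * (\sum_i g i) * (\sum_j h j).
Proof.
rewrite -(pair_bigA _ (fun (p : I0 * I1) j => f p.1 * g p.2 * h j))/=.
under eq_bigr do rewrite -mulr_sumr.
rewrite -mulr_suml; congr (_ * _).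
rewrite -(pair_bigA _ (fun i j => f i * g j))/=.
by under eq_bigr do rewrite -mulr_sumr; rewrite -mulr_suml.
Qed.

Variables (a0 : I0 -> bool) (a1 : I1 -> bool).
Let A0 : R := \sum_i (a0 i)%:R.
Let A1 : R := \sum_i (a1 i)%:R.
Let n0 : R := #|I0|%:R.
Let n1 : R := #|I1|%:R.
Let nJ : R := #|J|%:R.

Lemma sum_branch (g0 g1 G : J -> bool) :
  \sum_(p : I0 * I1 * J) ((a0 p.1.1)%:R * (g0 p.2)%:R + (a1 p.1.2)%:R * (g1 p.2)%:R -
     (a0 p.1.1)%:R * (a1 p.1.2)%:R * (G p.2)%:R) =
  A0 * n1 * (\sum_j (g0 j)%:R) + n0 * A1 * (\sum_j (g1 j)%:R) -
     A0 * A1 * (\sum_j (G j)%:R).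
Proof.
rewrite big_split sumrN big_split/=; congr (_ + _ - _).
- rewrite (eq_bigr (fun p : I0 * I1 * J => (a0 p.1.1)%:R * 1 * (g0 p.2)%:R)); last first.
    by move=> p _; rewrite mulr1.
  by rewrite (sum_prod3 (fun i => (a0 i)%:R) (fun=> 1) (fun j => (g0 j)%:R)) sumr_const.
- rewrite (eq_bigr (fun p : I0 * I1 * J => 1 * (a1 p.1.2)%:R * (g1 p.2)%:R)); last first.
    by move=> p _; rewrite mul1r.
  by rewrite (sum_prod3 (fun=> 1) (fun i => (a1 i)%:R) (fun j => (g1 j)%:R)) sumr_const.
- exact: (sum_prod3 (fun i => (a0 i)%:R) (fun i => (a1 i)%:R) (fun j => (G j)%:R)).
Qed.

Hypotheses (I0_gt0 : (0 < #|I0|)%N) (I1_gt0 : (0 < #|I1|)%N) (J_gt0 : (0 < #|J|)%N).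

Lemma mean01 (I : finType) (a : I -> bool) : (0 < #|I|)%N ->
  exists al : R, [/\ \sum_i (a i)%:R = al * #|I|%:R, 0 <= al & al <= 1].
Proof.
move=> I0'; have I0R : 0 < #|I|%:R :> R by rewrite ltr0n.
exists ((\sum_i (a i)%:R) / #|I|%:R); split.
- by rewrite divfK// gt_eqF.
- by rewrite divr_ge0// sumr_ge0.
- rewrite ler_pdivrMr// mul1r -sum1_card natr_sum; apply: ler_sum => i _.
  by case: (a i).
Qed.

(** Inclusion-exclusion under independence.  In the means x0, x1 of [a0], [a1] the
    bound c (x0 + x1) - v x0 x1 is increasing since v <= c, so both means may be
    replaced by [u]. *)
Lemma branch_upper (hit : I0 * I1 * J -> bool) (g0 g1 G : J -> bool) (u c v : R) :
  (forall p, hit p -> a0 p.1.1 && g0 p.2 || a1 p.1.2 && g1 p.2) ->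
  (forall j, G j -> g0 j && g1 j) ->
  A0 <= u * n0 -> A1 <= u * n1 -> 0 <= u <= 1 -> 0 <= v <= c ->
  \sum_j (g0 j)%:R <= c * nJ -> \sum_j (g1 j)%:R <= c * nJ ->
  v * nJ <= \sum_j (G j)%:R ->
  \sum_p (hit p)%:R <= (2 * c * u - v * u ^+ 2) * #|{: I0 * I1 * J}|%:R.
Proof.
move=> hitP GP; rewrite /A0 /A1 /n0 /n1 => Au0 Au1 /andP[u0 u1] /andP[v0 vc] Gc0 Gc1 Gv.
have [x0 [E0 x00 x01]] := mean01 a0 I0_gt0.
have [x1 [E1 x10 x11]] := mean01 a1 I1_gt0.
have [y0 [F0 y00 y01]] := mean01 g0 J_gt0.
have [y1 [F1 y10 y11]] := mean01 g1 J_gt0.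
have [z [Z z0 z1]] := mean01 G J_gt0.
have [P0 P1 PJ] : [/\ 0 < n0, 0 < n1 & 0 < nJ] by split; rewrite ltr0n.
move: Au0 Au1 Gc0 Gc1 Gv; rewrite E0 E1 F0 F1 Z !ler_pM2r// => xu0 xu1 yc0 yc1 vz.
rewrite !card_prod !natrM -/n0 -/n1 -/nJ.
apply: (@le_trans _ _ ((x0 * y0 + x1 * y1 - x0 * x1 * z) * (n0 * n1 * nJ))); last first.
  rewrite ler_pM2r ?mulr_gt0//.
  have h0 : x0 * y0 <= x0 * c by rewrite ler_wpM2l.
  have h1 : x1 * y1 <= x1 * c by rewrite ler_wpM2l.
  have h2 : x0 * x1 * v <= x0 * x1 * z by rewrite ler_wpM2l// mulr_ge0.
  have h3 : 0 <= (u - x0) * (c - u * v).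
    by rewrite mulr_ge0 ?subr_ge0//; nra.
  have h4 : 0 <= (u - x1) * (c - x0 * v).
    by rewrite mulr_ge0 ?subr_ge0//; nra.
  lra.
apply: (@le_trans _ _ (\sum_(p : I0 * I1 * J) ((a0 p.1.1)%:R * (g0 p.2)%:R +
    (a1 p.1.2)%:R * (g1 p.2)%:R - (a0 p.1.1)%:R * (a1 p.1.2)%:R * (G p.2)%:R))).
  apply: ler_sum => p _; have := hitP p; have := GP p.2.
  case: (hit p); case: (a0 _); case: (a1 _); case: (g0 _); case: (g1 _);
    case: (G _) => //= H1 H2; (try by have := H1 isT); (try by have := H2 isT);
    rewrite ?(mulr0, mul0r, mulr1, addr0, add0r, subr0, oppr0, subrr) ?addrK ?lerr ?ler01//; lra.
rewrite sum_branch /A0 /A1 E0 E1 F0 F1 Z /n0 /n1 /nJ le_eqVlt; apply/orP; left.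
by apply/eqP; ring.
Qed.

(** The same computation from below, monotone for the same reason. *)
Lemma branch_lower (hit : I0 * I1 * J -> bool) (g0 g1 G : J -> bool) (l c w : R) :
  (forall p, a0 p.1.1 && g0 p.2 || a1 p.1.2 && g1 p.2 -> hit p) ->
  (forall j, g0 j && g1 j -> G j) ->
  l * n0 <= A0 -> l * n1 <= A1 -> 0 <= l <= 1 -> 0 <= w <= c ->
  c * nJ <= \sum_j (g0 j)%:R -> c * nJ <= \sum_j (g1 j)%:R ->
  \sum_j (G j)%:R <= w * nJ ->
  (2 * c * l - w * l ^+ 2) * #|{: I0 * I1 * J}|%:R <= \sum_p (hit p)%:R.
Proof.
move=> hitP GP; rewrite /A0 /A1 /n0 /n1 => Au0 Au1 /andP[l0 l1] /andP[w0 wc] Gc0 Gc1 Gv.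
have [x0 [E0 x00 x01]] := mean01 a0 I0_gt0.
have [x1 [E1 x10 x11]] := mean01 a1 I1_gt0.
have [y0 [F0 y00 y01]] := mean01 g0 J_gt0.
have [y1 [F1 y10 y11]] := mean01 g1 J_gt0.
have [z [Z z0 z1]] := mean01 G J_gt0.
have [P0 P1 PJ] : [/\ 0 < n0, 0 < n1 & 0 < nJ] by split; rewrite ltr0n.
move: Au0 Au1 Gc0 Gc1 Gv; rewrite E0 E1 F0 F1 Z !ler_pM2r// => xl0 xl1 yc0 yc1 vz.
rewrite !card_prod !natrM -/n0 -/n1 -/nJ.
apply: (@le_trans _ _ ((x0 * y0 + x1 * y1 - x0 * x1 * z) * (n0 * n1 * nJ))).
  rewrite ler_pM2r ?mulr_gt0//.
  have h0 : x0 * c <= x0 * y0 by rewrite ler_wpM2l.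
  have h1 : x1 * c <= x1 * y1 by rewrite ler_wpM2l.
  have h2 : x0 * x1 * z <= x0 * x1 * w by rewrite ler_wpM2l// mulr_ge0.
  have h3 : 0 <= (x0 - l) * (c - l * w).
    by rewrite mulr_ge0 ?subr_ge0//; nra.
  have h4 : 0 <= (x1 - l) * (c - x0 * w).
    by rewrite mulr_ge0 ?subr_ge0//; nra.
  lra.
apply: (@le_trans _ _ (\sum_(p : I0 * I1 * J) ((a0 p.1.1)%:R * (g0 p.2)%:R +
    (a1 p.1.2)%:R * (g1 p.2)%:R - (a0 p.1.1)%:R * (a1 p.1.2)%:R * (G p.2)%:R))).
  rewrite sum_branch /A0 /A1 E0 E1 F0 F1 Z /n0 /n1 /nJ le_eqVlt; apply/orP; left.
  by apply/eqP; ring.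
apply: ler_sum => p _; have := hitP p; have := GP p.2.
case: (hit p); case: (a0 _); case: (a1 _); case: (g0 _); case: (g1 _);
  case: (G _) => //= H1 H2; (try by have := H1 isT); (try by have := H2 isT);
    rewrite ?(mulr0, mul0r, mulr1, addr0, add0r, subr0, oppr0, subrr) ?addrK ?lerr ?ler01//; lra.
Qed.

End Branching.

(** * Random families of lines in the plane *)

Section StickyFamily.
Variable R : realType.
Implicit Types (S : set R) (x y s e : R).

(** The tolerance [e] is positive in upper bounds, where lines stand for thin
    tubes, and zero in lower bounds. *)
Definition hits (e : R) (B : set (R * R)) (x y : R) : bool :=
  `[< exists2 p, B p & `|y - p.1 * x - p.2| <= e >].

Lemma floor_near (a b : R) : `|a - b| < 1 ->
  [\/ Num.floor b = Num.floor a - 1, Num.floor b = Num.floor a |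
      Num.floor b = Num.floor a + 1].
Proof.
rewrite ltr_norml => /andP[h1 h2].
have /andP[a1 a2] := floor_itv a; have /andP[b1 b2] := floor_itv b.
have : Num.floor b < Num.floor a + 2.
  by rewrite -(ltr_int R) intrD; move: a2; rewrite intrD1; lra.
have : Num.floor a < Num.floor b + 2.
  by rewrite -(ltr_int R) intrD; move: b2; rewrite intrD1; lra.
move=> ? ?; have : Num.floor b = Num.floor a - 1 \/ Num.floor b = Num.floor a \/
      Num.floor b = Num.floor a + 1 by lia.
by case=> [|[]] ->; [constructor 1|constructor 2|constructor 3].
Qed.

Lemma int_drift (c c' : int) (h : nat) : c' < c + 1 -> c < c' + h%:Z + 1 ->
  exists2 D : nat, c' = c - D%:Z & (D <= h)%N.
Proof. by move=> ? ?; exists `|c - c'|%N; lia. Qed.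

(** Stripes of period [P] in the intercept, shifted by [i.2] / (2 h) of a period. *)
Definition sticky_split h (P : R) (I0 I1 : finType) (B0 : I0 -> set (R * R))
    (B1 : I1 -> set (R * R)) (i : I0 * I1 * 'I_(2 * h)) : set (R * R) :=
  [set p | B0 i.1.1 p /\ phase h (Num.floor (p.2 / P * (2 * h)%:R) - i.2%:Z) \/
           B1 i.1.2 p /\ ~~ phase h (Num.floor (p.2 / P * (2 * h)%:R) - i.2%:Z)].

Section Step.
Variables (h : nat) (I0 I1 : finType) (B0 : I0 -> set (R * R)) (B1 : I1 -> set (R * R)).
Variables (t0 t1 delta : R).
Hypotheses (h2 : (2 < h)%N) (delta0 : 0 < delta) (sep : (2 * h)%:R * delta < t1 - t0).
Hypothesis B0t : forall i p, B0 i p -> t0 - delta <= p.1 <= t0 + delta.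
Hypothesis B1t : forall i p, B1 i p -> t1 - delta <= p.1 <= t1 + delta.
Variables (x y e : R).
Hypotheses (x02 : 0 <= x <= 2) (e0 : 0 <= e <= delta).

Let g := t1 - t0.
Let P := 4 * g.
Let c0 := Num.floor ((y - t0 * x) / P * (2 * h)%:R).
Let c1 := Num.floor ((y - t1 * x) / P * (2 * h)%:R).
Let B := @sticky_split h P I0 I1 B0 B1.

Let g_gt0 : 0 < g.
Proof. by apply: le_lt_trans sep; rewrite mulr_ge0// ltW. Qed.

Let near_floor (t : R) (p : R * R) : t - delta <= p.1 <= t + delta ->
  `|y - p.1 * x - p.2| <= e ->
  `|(y - t * x) / P * (2 * h)%:R - p.2 / P * (2 * h)%:R| < 1.
Proof.
move=> pt pe; rewrite -mulrBl -mulrBl normrM (ger0_norm (ler0n _ _)) normrM.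
have P0 : 0 < P by rewrite mulr_gt0.
rewrite normfV (ger0_norm (ltW P0)) mulrAC ltr_pdivrMr//.
have h0 : 0 <= (2 * h)%:R :> R by [].
have : `|y - t * x - p.2| <= 3 * delta.
  move: pe pt e0 x02; rewrite !ler_norml => /andP[? ?] /andP[? ?] /andP[? ?] /andP[? ?].
  have k1 : 0 <= (t + delta - p.1) * x by rewrite mulr_ge0// subr_ge0.
  have k2 : 0 <= (p.1 - (t - delta)) * x by rewrite mulr_ge0// subr_ge0.
  have k3 : 0 <= delta * (2 - x) by rewrite mulr_ge0 ?subr_ge0// ltW.
  by apply/andP; split; lra.
rewrite mul1r => le3; apply: le_lt_trans (_ : 3 * delta * (2 * h)%:R < _).
  by rewrite ler_wpM2r.
by have := sep; have := g_gt0; rewrite /P /g; lra.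
Qed.

Lemma hits_upper (i : I0 * I1 * 'I_(2 * h)) : hits e (B i) x y ->
  hits e (B0 i.1.1) x y &&
    [|| phase h (c0 - 1 - i.2%:Z), phase h (c0 - i.2%:Z) | phase h (c0 + 1 - i.2%:Z)] ||
  hits e (B1 i.1.2) x y &&
    [|| ~~ phase h (c1 - 1 - i.2%:Z), ~~ phase h (c1 - i.2%:Z) | ~~ phase h (c1 + 1 - i.2%:Z)].
Proof.
move=> /asboolP[p [] [Bp ph] pe]; apply/orP; [left|right]; apply/andP; split.
- by apply/asboolP; exists p.
- by have [E|E|E] := floor_near (near_floor (B0t Bp) pe); move: ph; rewrite E => ->;
    rewrite ?orbT.
- by apply/asboolP; exists p.
- by have [E|E|E] := floor_near (near_floor (B1t Bp) pe); move: ph; rewrite E => ->;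
    rewrite ?orbT.
Qed.

Lemma hits_lower (i : I0 * I1 * 'I_(2 * h)) :
  hits e (B0 i.1.1) x y &&
    [&& phase h (c0 - 1 - i.2%:Z), phase h (c0 - i.2%:Z) & phase h (c0 + 1 - i.2%:Z)] ||
  hits e (B1 i.1.2) x y &&
    [&& ~~ phase h (c1 - 1 - i.2%:Z), ~~ phase h (c1 - i.2%:Z) & ~~ phase h (c1 + 1 - i.2%:Z)] ->
  hits e (B i) x y.
Proof.
case/orP=> /andP[/asboolP[p Bp pe] /and3P[h3 h4 h5]]; apply/asboolP; exists p => //.
  by left; split=> //; have [E|E|E] := floor_near (near_floor (B0t Bp) pe); rewrite E.
by right; split=> //; have [E|E|E] := floor_near (near_floor (B1t Bp) pe); rewrite E.
Qed.

(** Between the two base slopes the point moves by x (t1 - t0) = (x / 4) P, which is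
    x h / 2 units of the discretised period. *)
Lemma phase_drift : exists2 D : nat, c1 = c0 - D%:Z &
  (D <= h)%N /\ x * h%:R / 2 - 1 <= D%:R <= x * h%:R / 2 + 1.
Proof.
have hR : 0 < h%:R :> R by rewrite ltr0n; lia.
have dE : (y - t0 * x) / P * (2 * h)%:R = (y - t1 * x) / P * (2 * h)%:R + x * h%:R / 2.
  by rewrite /P natrM /g; field; rewrite -/g gt_eqF.
have /andP[a1 a2] := floor_itv ((y - t0 * x) / P * (2 * h)%:R).
have /andP[b1 b2] := floor_itv ((y - t1 * x) / P * (2 * h)%:R).
rewrite -/c0 -/c1 dE !intrD1 in a1 a2 b1 b2.
have xh : 0 <= x * h%:R / 2 <= h%:R.
  move/andP: x02 => [x0 x2].
  have := mulr_ge0 x0 (ltW hR); have : 0 <= (2 - x) * h%:R by rewrite mulr_ge0 ?subr_ge0// ltW.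
  by move=> ? ?; apply/andP; split; lra.
have D0 : c1 < c0 + 1 by rewrite -(ltr_int R) intrD1; lra.
have Dh : c0 < c1 + h%:Z + 1 by rewrite -(ltr_int R) intrD1 intrD -pmulrn; lra.
have [D DE Dh'] := int_drift D0 Dh.
exists D => //; split=> //.
have -> : (D%:R : R) = c0%:~R - c1%:~R.
  by rewrite -intrB pmulrn DE opprB addrC subrK.
by apply/andP; split; lra.
Qed.

End Step.

Lemma hits_mono e e' (B : set (R * R)) x y : e <= e' -> hits e B x y -> hits e' B x y.
Proof.
move=> ee' /asboolP[p Bp pe]; apply/asboolP; exists p => //; exact: le_trans ee'.
Qed.

(** 16 / (k + 16) is a supersolution of p' = p - p ^ 2 / 8 with room for the
    discretisation error as long as k < N. *)
Lemma upper_recursion (N k : nat) : (k < N)%N ->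
  let u := 16 / (k%:R + 16) : R in
  2 * ((64 * N + 2)%:R / (2 * (64 * N))%:R) * u - 1 / 8 * u ^+ 2 <= 16 / (k.+1%:R + 16).
Proof.
move=> kN /=; have N0 : 0 < N%:R :> R by rewrite ltr0n; lia.
have kNR : k%:R + 1 <= N%:R :> R by rewrite natr1 ler_nat.
have N1 : 1 <= N%:R :> R by rewrite ler1n; lia.
have k0 : 0 <= k%:R :> R by [].
rewrite natrD !natrM -[k.+1%:R]natr1.
set n : R := N%:R in N0 kNR N1 *; set m : R := k%:R in kNR k0 *.
rewrite -subr_ge0 (_ : _ - _ = (16 * (m + 16)^-1) * (2 / (m + 16) - (m + 17)^-1 - (32 * n)^-1)); last first.
  by field; repeat (apply/andP; split); rewrite gt_eqF //; lra.
apply: mulr_ge0; first by rewrite mulr_ge0// invr_ge0; lra.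
have q1 : (m + 17)^-1 <= (m + 16)^-1 by rewrite lef_pV2 ?posrE; lra.
have q2 : (32 * n)^-1 <= (m + 16)^-1 by rewrite lef_pV2 ?posrE; lra.
lra.
Qed.

(** 1 / (1 + k x) is a subsolution: its decrement is about x p ^ 2, four times what
    the recursion subtracts, and the error terms, of order p / N, are absorbed
    because x p is at least of order 1 / N. *)
Lemma lower_recursion (N k : nat) x : (k < N)%N -> N%:R^-1 <= x <= 1 ->
  let l := 1 / (1 + k%:R * x) : R in
  1 / (1 + k.+1%:R * x) <= 2 * ((64 * N - 2)%:R / (2 * (64 * N))%:R) * l -
    (x / 4 + 1 / (2 * (64 * N))%:R) * l ^+ 2.
Proof.
move=> kN /andP[Nx x1] /=; have N0 : 0 < N%:R :> R by rewrite ltr0n; lia.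
have kNR : k%:R + 1 <= N%:R :> R by rewrite natr1 ler_nat.
have k0 : 0 <= k%:R :> R by [].
have x0 : 0 < x by apply: lt_le_trans Nx; rewrite invr_gt0.
rewrite natrB ?natrM -?[k.+1%:R]natr1; last lia.
set n : R := N%:R in N0 kNR Nx *; set m : R := k%:R in kNR k0 *.
have mx0 : 0 <= m * x by rewrite mulr_ge0// ltW.
have ni0 : 0 < n^-1 by rewrite invr_gt0.
set D := 1 + m * x.
have D1 : 1 <= D by rewrite /D; lra.
have nD : n^-1 * D <= 2 * x.
  have : m * x * n^-1 <= x * (n * n^-1).
    rewrite mulrA; apply: ler_wpM2r; first exact: ltW.
    by rewrite [m * x]mulrC; apply: ler_wpM2l; lra.
  by rewrite divff ?gt_eqF// /D; lra.
rewrite (_ : 1 + (m + 1) * x = D + x); last by rewrite /D; ring.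
rewrite -subr_ge0 (_ : _ - _ = (x * D - n^-1 / 32 * D * D - n^-1 / 32 * D * x -
   (x / 4 + n^-1 / 128) * (D + x)) / (D ^+ 2 * (D + x))); last first.
  by field; repeat (apply/andP; split); rewrite gt_eqF //; lra.
have q1 : n^-1 * D * D <= 2 * x * D by apply: ler_wpM2r; lra.
have q2 : n^-1 * D * x <= 2 * x * x by apply: ler_wpM2r; lra.
have q3 : x * x <= x * D by apply: ler_wpM2l; lra.
have q4 : n^-1 * x <= x * x by apply: ler_wpM2r; lra.
have q5 : n^-1 * D <= x * D by apply: ler_wpM2r; lra.
have q6 : 0 <= x * D by apply: mulr_ge0; lra.
apply: divr_ge0; first lra.
by apply: mulr_ge0; [apply: exprn_ge0; lra|lra].
Qed.

(** The index set [I] is the probability space of all shifts.  The period is split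
    into 128 N units so that the errors of the N levels add up to less than the
    effect of the branching. *)
Lemma sticky_family (N k : nat) S : (0 < N)%N -> (k <= N)%N ->
  separated_tree (2 * (64 * N)) k S ->
  exists (I : finType) (B : I -> set (R * R)) (eta : R),
  [/\ (0 < #|I|)%N, 0 < eta, (forall i p, B i p -> S p.1),
    (forall x y, 1 <= x <= 2 ->
      \sum_i (hits eta (B i) x y)%:R <= 16 / (k%:R + 16) * #|I|%:R :> R) &
    (forall x y, N%:R^-1 <= x <= 1 ->
      1 / (1 + k%:R * x) * #|I|%:R <= \sum_i (hits 0 (B i) x y)%:R)].
Proof.
move=> N0; elim: k S => [|k IHk] S kN.
  move=> [s Ss]; exists unit, (fun=> [set p | p.1 = s]), 1; split => //.
  - by rewrite card_unit.
  - by move=> _ p ->.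
  - move=> x y _; rewrite add0r divff// mul1r -sum1_card natr_sum.
    by apply: ler_sum => i _; case: hits.
  - move=> x y _; rewrite mul0r addr0 divr1 mul1r -sum1_card natr_sum.
    apply: ler_sum => i _; rewrite (_ : hits _ _ _ _)//; apply/asboolP.
    by exists (s, y - s * x) => //=; rewrite subrr normr0.
move=> [t0 [t1 [delta [delta0 sep]]]].
move=> /(IHk _ (ltnW kN))[I0 [B0 [e0 [I00 e00 B0S up0 lo0]]]].
move=> /(IHk _ (ltnW kN))[I1 [B1 [e1 [I10 e10 B1S up1 lo1]]]].
pose h := (64 * N)%N; have h2 : (2 < h)%N by rewrite /h; lia.
have B0t i p : B0 i p -> t0 - delta <= p.1 <= t0 + delta.
  by move=> /B0S[_]; rewrite /= in_itv.
have B1t i p : B1 i p -> t1 - delta <= p.1 <= t1 + delta.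
  by move=> /B1S[_]; rewrite /= in_itv.
have J0 : (0 < #|'I_(2 * h)|)%N by rewrite card_ord; lia.
have q0 : (2 * h)%:R != 0 :> R by rewrite pnatr_eq0; lia.
have h_2 : (1 < h)%N by lia.
have hR : 0 < h%:R :> R by rewrite ltr0n; lia.
have hR64 : 64 <= h%:R :> R by rewrite ler_nat /h; lia.
pose eta := Num.min delta (Num.min e0 e1).
have [d1 d2 d3] : [/\ eta <= delta, eta <= e0 & eta <= e1].
  by rewrite /eta !ge_min !lexx !orbT.
have eta0 : 0 < eta by rewrite /eta !lt_min delta0 e00.
exists (I0 * I1 * 'I_(2 * h))%type, (sticky_split (4 * (t1 - t0)) B0 B1), eta; split => //.
- by rewrite !card_prod !muln_gt0 I00 I10.
- by move=> i p [] [] => [/B0S[]|/B1S[]].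
- move=> x y /andP[x1 x2].
  have x02 : 0 <= x <= 2 by lra.
  have e0d : 0 <= eta <= delta by rewrite ltW.
  have [D c1E [Dh /andP[D1 D2]]] := phase_drift h2 delta0 sep y x02 e0d.
  set c0 := Num.floor ((y - t0 * x) / _ * _) in c1E.
  set c1 := Num.floor _ in c1E.
  apply: le_trans (_ : _ <= (2 * ((h + 2)%:R / (2 * h)%:R) * (16 / (k%:R + 16)) -
      1 / 8 * (16 / (k%:R + 16)) ^+ 2) * #|{: I0 * I1 * 'I_(2 * h)}|%:R) _; last first.
    by rewrite ler_wpM2r//; exact: upper_recursion.
  apply: (@branch_upper _ _ _ _ (fun i => hits eta (B0 i) x y) (fun i => hits eta (B1 i) x y)
    I00 I10 J0 _
    (fun j : 'I_(2 * h) => [|| phase h (c0 - 1 - j%:Z), phase h (c0 - j%:Z) |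
       phase h (c0 + 1 - j%:Z)])
    (fun j : 'I_(2 * h) => [|| ~~ phase h (c1 - 1 - j%:Z), ~~ phase h (c1 - j%:Z) |
       ~~ phase h (c1 + 1 - j%:Z)])
    (fun j : 'I_(2 * h) => phase h (c0 - j%:Z) && ~~ phase h (c1 - j%:Z))).
  - by move=> i hi; exact: (hits_upper delta0 sep B0t B1t x02 e0d hi).
  - by move=> j /andP[-> ->]; rewrite !orbT.
  - apply: le_trans (up0 x y _); last by rewrite x1.
    by apply: ler_sum => i _; case E: (hits eta _ _ _) => //; rewrite (hits_mono d2 E).
  - apply: le_trans (up1 x y _); last by rewrite x1.
    by apply: ler_sum => i _; case E: (hits eta _ _ _) => //; rewrite (hits_mono d3 E).
  - rewrite divr_ge0 ?addr_ge0// ler_pdivrMr ?ltr_wpDl//.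
    by have := ler0n R k; lra.
  - rewrite natrD natrM; apply/andP; split; first lra.
    by rewrite ler_pdivlMr; lra.
  - rewrite card_ord divfK//.
    by rewrite -natr_sum ler_nat; exact: count_phase_some.
  - rewrite card_ord divfK//.
    by rewrite -natr_sum ler_nat; exact: count_not_phase_some.
  - rewrite card_ord -natr_sum c1E count_phase_switch// natrM.
    have : h%:R <= x * h%:R by rewrite ler_peMl// ltW.
    lra.
- move=> x y xN; have /andP[x1 x2] := xN.
  have x0 : 0 < x by apply: lt_le_trans x1; rewrite invr_gt0 ltr0n.
  have x02 : 0 <= x <= 2 by lra.
  have e0d : (0 : R) <= 0 <= delta by rewrite lexx ltW.
  have [D c1E [Dh /andP[D1 D2]]] := phase_drift h2 delta0 sep y x02 e0d.
  set c0 := Num.floor ((y - t0 * x) / _ * _) in c1E.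
  set c1 := Num.floor _ in c1E.
  have kx : 0 <= k%:R * x by rewrite mulr_ge0// ltW.
  have xh : x * h%:R <= h%:R by rewrite ger_pMl.
  apply: le_trans (_ : (2 * ((h - 2)%:R / (2 * h)%:R) * (1 / (1 + k%:R * x)) -
      (x / 4 + 1 / (2 * h)%:R) * (1 / (1 + k%:R * x)) ^+ 2) *
        #|{: I0 * I1 * 'I_(2 * h)}|%:R <= _).
    by rewrite ler_wpM2r//; exact: lower_recursion.
  apply: (@branch_lower _ _ _ _ (fun i => hits 0 (B0 i) x y) (fun i => hits 0 (B1 i) x y)
    I00 I10 J0 _
    (fun j : 'I_(2 * h) => [&& phase h (c0 - 1 - j%:Z), phase h (c0 - j%:Z) &
       phase h (c0 + 1 - j%:Z)])
    (fun j : 'I_(2 * h) => [&& ~~ phase h (c1 - 1 - j%:Z), ~~ phase h (c1 - j%:Z) &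
       ~~ phase h (c1 + 1 - j%:Z)])
    (fun j : 'I_(2 * h) => phase h (c0 - j%:Z) && ~~ phase h (c1 - j%:Z))).
  - by move=> i hi; apply: (hits_lower delta0 sep B0t B1t x02 e0d hi).
  - by move=> j /andP[/and3P[_ -> _] /and3P[_ -> _]].
  - exact: lo0.
  - exact: lo1.
  - rewrite divr_ge0 ?addr_ge0// ler_pdivrMr ?ltr_wpDr//; lra.
  - rewrite natrB// (natrM _ 2 h).
    apply/andP; split; first by rewrite addr_ge0// divr_ge0// ltW.
    have -> : x / 4 + 1 / (2 * h%:R) = (x * h%:R / 2 + 1) / (2 * h%:R) by field; rewrite gt_eqF.
    by rewrite ler_pM2r ?invr_gt0; lra.
  - rewrite card_ord divfK//.
    by rewrite -natr_sum ler_nat; exact: count_phase_all.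
  - rewrite card_ord divfK//.
    by rewrite -natr_sum ler_nat; exact: count_not_phase_all.
  - rewrite card_ord -natr_sum c1E count_phase_switch// (natrM _ 2 h).
    apply: le_trans D2 _; rewrite le_eqVlt; apply/orP; left; apply/eqP.
    by field; rewrite gt_eqF.
Qed.

End StickyFamily.

(** * Euclidean geometry of tubes and frames *)

Section Euclid.
Variables (R : realType) (n : nat).
Implicit Types x y z : 'rV[R]_n.

Lemma dotpE x y : dotp x y = (x *m y^T) ord0 ord0.
Proof. by rewrite mxE; apply: eq_bigr => i _; rewrite mxE. Qed.

Lemma dotpC x y : dotp x y = dotp y x.
Proof. by apply: eq_bigr => i _; rewrite mulrC. Qed.

Lemma dotpDl x y z : dotp (x + y) z = dotp x z + dotp y z.
Proof. by rewrite !dotpE mulmxDl mxE. Qed.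

Lemma dotpZl c x y : dotp (c *: x) y = c * dotp x y.
Proof. by rewrite !dotpE -scalemxAl mxE. Qed.

Lemma dotpNl x y : dotp (- x) y = - dotp x y.
Proof. by rewrite -scaleN1r dotpZl mulN1r. Qed.

Lemma dotpDr x y z : dotp z (x + y) = dotp z x + dotp z y.
Proof. by rewrite dotpC dotpDl !(dotpC z). Qed.

Lemma dotpZr c x y : dotp y (c *: x) = c * dotp y x.
Proof. by rewrite dotpC dotpZl (dotpC y). Qed.

Lemma dotpNr x y : dotp y (- x) = - dotp y x.
Proof. by rewrite dotpC dotpNl (dotpC y). Qed.

Lemma dotp_ge0 x : 0 <= dotp x x.
Proof. by apply: sumr_ge0 => i _; rewrite -expr2 sqr_ge0. Qed.

Lemma enorm_ge0 x : 0 <= enorm x.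
Proof. exact: sqrtr_ge0. Qed.

Lemma enorm_sqr x : enorm x ^+ 2 = dotp x x.
Proof. by rewrite sqr_sqrtr// dotp_ge0. Qed.

Lemma enorm_le x (c : R) : 0 <= c -> (enorm x <= c) = (dotp x x <= c ^+ 2).
Proof. by move=> c0; rewrite -enorm_sqr ler_sqr ?nnegrE// enorm_ge0. Qed.

Lemma coord_le_enorm x i : `|x ord0 i| <= enorm x.
Proof.
rewrite -ler_sqr ?nnegrE ?enorm_ge0// enorm_sqr real_normK ?num_real//.
rewrite /dotp (bigD1 i)//= -expr2 lerDl; apply: sumr_ge0 => k _.
by rewrite -expr2 sqr_ge0.
Qed.

Lemma enorm_le_coord x (c : R) : 0 <= c -> (forall i, `|x ord0 i| <= c) ->
  enorm x <= n%:R * c.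
Proof.
move=> c0 xc.
rewrite enorm_le ?mulr_ge0// exprMn; apply: (@le_trans _ _ (\sum_(i < n) c ^+ 2)).
  apply: ler_sum => i _; rewrite -expr2 -[x _ _ ^+ 2]real_normK ?num_real//.
  by rewrite ler_sqr ?nnegrE.
rewrite sumr_const card_ord -[_ *+ n]mulr_natl ler_wpM2r ?sqr_ge0// -natrX ler_nat.
by rewrite -mulnn; case: (n) => // m; rewrite leq_pmulr.
Qed.

Lemma unit_proj_le (al e : 'rV[R]_n) : enorm al = 1 ->
  `|dotp e al| <= enorm e /\ enorm (e - dotp e al *: al) <= enorm e.
Proof.
move=> al1; have al2 : dotp al al = 1 by rewrite -enorm_sqr al1 expr1n.
have E : dotp (e - dotp e al *: al) (e - dotp e al *: al) =
    enorm e ^+ 2 - dotp e al ^+ 2.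
  rewrite dotpDl !dotpDr !dotpNl !dotpNr !dotpZl !dotpZr al2 (dotpC al e) enorm_sqr.
  by ring.
split; last by rewrite enorm_le ?enorm_ge0// E gerBl sqr_ge0.
rewrite -ler_sqr ?nnegrE ?enorm_ge0// real_normK ?num_real// -subr_ge0 -E.
exact: dotp_ge0.
Qed.

(** Splitting the small vector [e] along the axis and across it increases neither
    part. *)
Lemma tube_set_near_axis (T : tube R n) (s : R) (e : 'rV[R]_n) :
  enorm (axis T) = 1 -> `|s| + enorm e <= tlength T / 2 -> enorm e <= tradius T ->
  tube_set T (centre T + s *: axis T + e).
Proof.
move=> al1 se er; have al2 : dotp (axis T) (axis T) = 1 by rewrite -enorm_sqr al1 expr1n.
have [e1 e2] := unit_proj_le e al1.
rewrite /tube_set /=.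
have -> : centre T + s *: axis T + e - centre T = s *: axis T + e.
  by rewrite addrAC [centre T + _]addrC addrK.
have -> : dotp (s *: axis T + e) (axis T) = s + dotp e (axis T).
  by rewrite dotpDl dotpZl al2 mulr1.
split.
  by apply: le_trans (ler_normD _ _) _; apply: le_trans se; rewrite lerD2l.
rewrite scalerDl opprD addrACA subrr add0r; exact: le_trans er.
Qed.

End Euclid.

Section Frame.
Variables (R : realType) (d : nat) (nu : 'rV[R]_d.+1) (B : 'M[R]_(d, d.+1)).

Definition frame_point (x : R) (u : 'rV[R]_d) : 'rV[R]_d.+1 := x *: nu + u *m B.

Definition orthonormal_basis : Prop :=
  [/\ dotp nu nu = 1, nu *m B^T = 0 & B *m B^T = 1%:M].

Hypothesis onb : orthonormal_basis.

Lemma frame_pointB x u x' u' :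
  frame_point x u - frame_point x' u' = frame_point (x - x') (u - u').
Proof. by rewrite /frame_point scalerBl mulmxBl opprD addrACA. Qed.

Lemma dotp_frame_point x u :
  dotp (frame_point x u) (frame_point x u) = x ^+ 2 + dotp u u.
Proof.
have [nu1 nuB BB] := onb.
rewrite /frame_point dotpDl !dotpDr !dotpZl !dotpZr nu1.
have -> : dotp nu (u *m B) = 0.
  by rewrite dotpE trmx_mul mulmxA nuB mul0mx mxE.
rewrite dotpC.
have -> : dotp nu (u *m B) = 0.
  by rewrite dotpE trmx_mul mulmxA nuB mul0mx mxE.
have -> : dotp (u *m B) (u *m B) = dotp u u.
  by rewrite !dotpE trmx_mul mulmxA -(mulmxA u) BB mulmx1.
by ring.
Qed.

Lemma frame_point_coord_le x (u : 'rV[R]_d) (c : R) (i : 'I_d.+1) : 0 <= c -> `|x| <= c ->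
  (forall k, `|u ord0 k| <= c) -> `|frame_point x u ord0 i| <= d.+1%:R * c.
Proof.
move=> c0 xc uc; apply: le_trans (coord_le_enorm _ _) _.
rewrite enorm_le ?mulr_ge0// dotp_frame_point -enorm_sqr.
have := enorm_le_coord c0 uc; have := enorm_ge0 u.
have x2 : x ^+ 2 <= c ^+ 2 by rewrite -real_normK ?num_real// ler_sqr ?nnegrE.
move=> u0 ud; have u2 : enorm u ^+ 2 <= (d%:R * c) ^+ 2 by rewrite ler_sqr ?nnegrE ?mulr_ge0.
rewrite -[d.+1%:R]natr1 mulrDl mul1r sqrrD.
have : 0 <= d%:R * c * c by rewrite !mulr_ge0.
lra.
Qed.

Lemma frame_point_enorm_ge x (u : 'rV[R]_d) : `|x| <= enorm (frame_point x u) /\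
  forall k, `|u ord0 k| <= enorm (frame_point x u).
Proof.
have H (c : R) : c ^+ 2 <= x ^+ 2 + dotp u u -> `|c| <= enorm (frame_point x u).
  move=> hc; rewrite -ler_sqr ?nnegrE ?enorm_ge0// enorm_sqr dotp_frame_point.
  by rewrite real_normK ?num_real.
split=> [|k]; apply: H; first by rewrite lerDl dotp_ge0.
rewrite /dotp (bigD1 k)//= -expr2 addrCA lerDl addr_ge0 ?sqr_ge0//.
by apply: sumr_ge0 => l _; rewrite -expr2 sqr_ge0.
Qed.

End Frame.

Section SlopeTree.
Variables (R : realType) (d : nat) (Omega : set 'rV[R]_d.+1).

(** The foot of the perpendicular from the origin is at distance 1, hence completes
    the frame of the hyperplane to an orthonormal basis. *)
Lemma hyperplane_frame (V : set 'rV[R]_d.+1) a (B : 'M[R]_(d, d.+1)) :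
  orthonormal_frame V a B -> dist_origin V = 1 ->
  exists nu a', orthonormal_basis nu B /\ a = frame_point nu B 1 a'.
Proof.
move=> [BB VE] V1.
have BBT : B *m B^T = 1%:M.
  apply/matrixP => i j; rewrite [RHS]mxE -BB dotpE.
  by rewrite !mxE; apply: eq_bigr => k _; rewrite !mxE.
pose a' := a *m B^T; pose nu := a - a' *m B.
have nuB : nu *m B^T = 0 by rewrite mulmxBl -mulmxA BBT mulmx1 subrr.
exists nu, a'; split; last by rewrite /frame_point scale1r subrK.
split=> //.
have VP v : V v -> enorm nu <= enorm v.
  rewrite VE => -[x _ <-]; rewrite enorm_le ?enorm_ge0// enorm_sqr.
  have -> : a + x *m B = nu + (a' + x) *m B by rewrite mulmxDl addrA subrK.
  set w := (a' + x) *m B; rewrite (dotpDl nu w) (dotpDr nu w nu) (dotpDr nu w w) (dotpC w nu).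
  have -> : dotp nu w = 0 by rewrite dotpE trmx_mul mulmxA nuB mul0mx mxE.
  by rewrite addr0 add0r lerDl dotp_ge0.
suff : enorm nu = 1 by move=> nu1; rewrite -enorm_sqr nu1 expr1n.
have Vnu : V nu by rewrite VE; exists (- a') => //; rewrite mulNmx.
apply/eqP; rewrite -V1 eq_le; apply/andP; split.
  by apply: lb_le_inf; [exists (enorm nu), nu|move=> _ [v Vv <-]; exact: VP].
by apply: ge_inf; [exists (enorm nu) => _ [v Vv <-]; exact: VP|exists nu].
Qed.

Lemma precompact_enorm_bounded n (U : set 'rV[R]_n) : precompact U ->
  exists W, forall u, U u -> enorm u <= W.
Proof.
rewrite precompactE => /compact_bounded[M [_ HM]].
exists (n%:R * (`|M| + 1)) => u Uu; apply: enorm_le_coord => [|i].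
  by have := normr_ge0 M; lra.
have /(HM (`|M| + 1)) H : M < `|M| + 1 by have := ler_norm M; lra.
apply: le_trans (H _ (subset_closure Uu)).
rewrite [`|u|]mx_normrE; exact: (le_bigmax _ (fun k => `|u k.1 k.2|) (ord0, i)).
Qed.

(** The shift [c] is the difference between the given base point of the hyperplane
    and the foot of the perpendicular; it only shears the plane of the slopes. *)
Lemma sublacunary_tree N q : (1 <= N)%N -> (0 < q)%N -> sublacunary Omega ->
  exists (nu : 'rV[R]_d.+1) (B : 'M[R]_(d, d.+1)) (j : 'I_d) (c W : R)
    (Sl : set 'rV[R]_d),
  [/\ orthonormal_basis nu B,
    (forall w, Sl w -> cone Omega (frame_point nu B 1 w)),
    (forall w k, Sl w -> `|w ord0 k| <= W) &
    separated_tree q N [set w ord0 j - c | w in Sl]].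
Proof.
move=> N1 q0 subl; apply: contrapT => none.
have [r r0 cov] := @lacunary_cover_of_no_tree R q N q0.
apply: (subl N 2^-1) => //; first by rewrite invr_gt0 invf_lt1// ltr1n ltr0n.
exists r => // V _ V1 U UV cU; split=> // [x /UV[]//|a B aB j].
have [nu [a' [onb aE]]] := hyperplane_frame aB V1.
have [W UW] := precompact_enorm_bounded cU.
pose Sl := [set w : 'rV[R]_d | U (frame_point nu B 1 w)].
have SlW w k : Sl w -> `|w ord0 k| <= W.
  by move=> /UW; apply: le_trans; have [_] := frame_point_enorm_ge onb 1 w.
have projE : coord_proj a B j U = [set w ord0 j - a' ord0 j | w in Sl].
  have E x : a + x *m B = frame_point nu B 1 (x + a').
    by rewrite aE /frame_point mulmxDl -addrA (addrC (a' *m B)).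
  apply/seteqP; split => _ [x /= Ux <-].
    by exists (x + a'); [rewrite /Sl/= -E|rewrite mxE addrK].
  by exists (x - a'); [rewrite /= E subrK|rewrite !mxE].
apply: (cov _ (- W - a' ord0 j) (W - a' ord0 j)).
  rewrite projE => _ [w /(SlW _ j)] + <-; rewrite /= in_itv/= ler_norml; lra.
rewrite projE => T; apply: none; exists nu, B, j, (a' ord0 j), W, Sl; split=> //.
by move=> w /UV[].
Qed.

End SlopeTree.

(** * Tubes over a planar family of lines *)

Section TubeFamily.
Variables (R : realType) (d : nat).
Variables (nu : 'rV[R]_d.+1) (B : 'M[R]_(d, d.+1)) (j : 'I_d) (c W : R).
Variable Sl : set 'rV[R]_d.
Hypothesis onb : orthonormal_basis nu B.
Hypothesis SlW : forall w k, Sl w -> `|w ord0 k| <= W.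
Variable Bf : set (R * R).
Hypothesis BfS : forall p, Bf p -> [set w ord0 j - c | w in Sl] p.1.
Variables (H N Q : nat) (eta : R).
Hypotheses (N0 : (0 < N)%N) (Q0 : (0 < Q)%N).
Hypothesis HW : 2 * W <= H%:R.
Let eps : R := (N * Q)%:R^-1.
Hypothesis eps_eta : eps * (1 + W) <= eta.

Let pt := frame_point nu B.

(** The tube lies over x in [1, 2] and its axis meets x = 0 at [u]; the axis of its
    threefold dilate covers x in [0, 3]. *)
Definition tube_of (rho : R) (w u : 'rV[R]_d) : tube R d.+1 :=
  let om := pt 1 w in
  Tube (pt (3 / 2) (u + (3 / 2) *: w)) ((enorm om)^-1 *: om) (enorm om) rho.

(** Only the coordinate [j] is constrained by the planar family; every coordinate is
    confined to a cube of size comparable to [H]. *)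
Definition tubes (rho : R) : set (tube R d.+1) :=
  [set T | exists w (u : 'rV[R]_d), [/\ Sl w, Bf (w ord0 j - c, u ord0 j),
     forall k, `|u ord0 k| <= 2 * H%:R & T = tube_of rho w u]].

Lemma direction_norm_ge1 w : 1 <= enorm (pt 1 w).
Proof. by have [] := frame_point_enorm_ge onb 1 w; rewrite normr1. Qed.

Lemma axis_unit rho w u : enorm (axis (tube_of rho w u)) = 1.
Proof.
have om0 : 0 < enorm (pt 1 w) by apply: lt_le_trans (direction_norm_ge1 w).
have E : enorm (axis (tube_of rho w u)) ^+ 2 = 1.
  rewrite enorm_sqr /= dotpZl dotpZr -enorm_sqr.
  by rewrite mulrA -expr2 -exprMn mulVf ?expr1n// gt_eqF.
by apply/eqP; rewrite -(@eqrXn2 _ 2) ?enorm_ge0// E expr1n.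
Qed.

Lemma axis_point rho w u (s : R) : let T := tube_of rho w u in
  let x := 3 / 2 + s / enorm (pt 1 w) in
  centre T + s *: axis T = pt x (u + x *: w).
Proof.
move=> /=; set om := enorm (pt 1 w); set x := 3 / 2 + _.
rewrite scalerA [pt 1 w]/pt/frame_point scale1r /pt /frame_point /x.
rewrite !mulmxDl -!scalemxAl; move: (u *m B) (w *m B) => uB wB.
by apply/rowP => i; rewrite !mxE; ring.
Qed.

Definition grid_row (o : R) m (f : {ffun 'I_d -> 'I_m}) : 'rV[R]_d :=
  \row_k (o + (f k)%:R * eps).

Definition fine_grid := ('I_(N * Q).+1 * {ffun 'I_d -> 'I_(6 * H * (N * Q)).+1})%type.
Definition fine_point (g : fine_grid) :=
  pt (1 + g.1%:R * eps) (grid_row (- 3 * H%:R) g.2).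
Definition fine_hits (g : fine_grid) := hits eta Bf (1 + g.1%:R * eps)
  (grid_row (- 3 * H%:R) g.2 ord0 j - c * (1 + g.1%:R * eps)).

Definition coarse_grid := ('I_(N.-1 * Q) * {ffun 'I_d -> 'I_(2 * H * (N * Q))})%type.
Definition coarse_point (g : coarse_grid) :=
  pt (N%:R^-1 + g.1%:R * eps) (grid_row (- H%:R) g.2).
Definition coarse_hits (g : coarse_grid) := hits 0 Bf (N%:R^-1 + g.1%:R * eps)
  (grid_row (- H%:R) g.2 ord0 j - c * (N%:R^-1 + g.1%:R * eps)).

Let NQ0 : 0 < (N * Q)%:R :> R.
Proof. by rewrite ltr0n muln_gt0 N0. Qed.

Let eps0 : 0 < eps.
Proof. by rewrite invr_gt0. Qed.

Let NQeps : (N * Q)%:R * eps = 1.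
Proof. by rewrite divff// gt_eqF. Qed.

Lemma grid_round (t : R) m : 0 <= t <= m%:R -> exists k : 'I_(m * (N * Q)).+1,
  k%:R * eps <= t <= k%:R * eps + eps.
Proof.
move=> /andP[t0 tm]; have y0 : 0 <= t / eps by rewrite divr_ge0// ltW.
have := truncn_itv y0; set i := Num.trunc _ => /andP[].
rewrite ler_pdivlMr// ltr_pdivrMr// => i1 i2.
have im : (i < (m * (N * Q)).+1)%N.
  rewrite ltnS -(ler_nat R) natrM -(ler_pM2r eps0) -mulrA NQeps mulr1.
  exact: le_trans tm.
exists (Ordinal im); rewrite /= i1/=; move: i2; rewrite -natr1 mulrDl mul1r; exact: ltW.
Qed.

(** A point of a tube is within [rho] of a point of its axis over x in [1, 2], which
    is rounded to the grid; the rounding error is within the tolerance of the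
    planar family. *)
Lemma tubes_cover rho z : 0 <= rho <= eps -> (\bigcup_(T in tubes rho) tube_set T) z ->
  exists2 g, fine_hits g & forall i, `|z ord0 i - fine_point g ord0 i| <= (d.+2)%:R * eps.
Proof.
move=> /andP[rho0 rhoe] [T [w [u [Sw Bw uH ->]]]].
have al1 := axis_unit rho w u; have om1 := direction_norm_ge1 w.
rewrite /tube_set /=; set om := enorm (pt 1 w) in om1 *.
have om0 : 0 < om by apply: lt_le_trans om1.
set al := om^-1 *: pt 1 w; set ce := pt _ _; set s := dotp _ _.
move=> [s1 z1]; have := axis_point rho w u s; rewrite /= -/om -/al -/ce.
set x := 3 / 2 + s / om => ax.
have [x1 x2] : 1 <= x /\ x <= 2.
  have : `|s / om| <= 2^-1.
    by rewrite normrM (gtr0_norm (_ : 0 < om^-1)) ?invr_gt0// ler_pdivrMr// mulrC.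
  by rewrite ler_norml /x => /andP[? ?]; split; lra.
have [|kx /andP[kx1 kx2]] := @grid_round (x - 1) 1; first lra.
pose v := u + x *: w.
have vH k : `|v ord0 k| <= 3 * H%:R.
  rewrite !mxE; apply: le_trans (ler_normD _ _) _; have := uH k.
  rewrite normrM (ger0_norm (_ : 0 <= x)); last lra.
  have := SlW k Sw; have := normr_ge0 (w ord0 k) => w0 wW.
  have : x * `|w ord0 k| <= 2 * W by apply: ler_pM; lra.
  by have := HW; lra.
(* The bound 3 H on the coordinates is what sizes the grid. *)
have /fin_all_exists[f fP] : forall k : 'I_d, exists m : 'I_(6 * H * (N * Q)).+1,
    m%:R * eps <= v ord0 k + 3 * H%:R <= m%:R * eps + eps.
  move=> k; apply: grid_round; have := vH k; rewrite ler_norml natrM; lra.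
have kxP : (kx < (N * Q).+1)%N by have := ltn_ord kx; move: (nat_of_ord kx) => m; rewrite mul1n.
pose g : fine_grid := (Ordinal kxP, [ffun k => f k]).
have dv k : `|v ord0 k - grid_row (- 3 * H%:R) g.2 ord0 k| <= eps.
  by rewrite [grid_row _ _ _ _]mxE /g /= ffunE ler_norml; have := fP k; lra.
have dx : `|x - (1 + kx%:R * eps)| <= eps by rewrite ler_norml; lra.
exists g.
  apply/asboolP; exists (w ord0 j - c, u ord0 j) => //=.
  apply: le_trans eps_eta.
  set yg := grid_row _ _ _ _.
  have -> : yg - c * (1 + kx%:R * eps) - (w ord0 j - c) * (1 + kx%:R * eps) - u ord0 j =
     (yg - v ord0 j) + w ord0 j * (x - (1 + kx%:R * eps)).
    by rewrite !mxE; ring.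
  apply: le_trans (ler_normD _ _) _; rewrite [eps * _]mulrDr mulr1 lerD//.
    by rewrite distrC.
  by rewrite normrM mulrC ler_pM// SlW.
move=> i; rewrite -[z](subrK (ce + s *: al)).
have -> : z - (ce + s *: al) = z - ce - s *: al by rewrite opprD addrA.
rewrite mxE -addrA; apply: le_trans (ler_normD _ _) _.
rewrite -[d.+2%:R]natr1 [d.+1%:R + 1]addrC mulrDl mul1r lerD//.
  by apply: le_trans rhoe; apply: le_trans z1; exact: coord_le_enorm.
rewrite ax -/v; set p := pt x v; set q := fine_point g.
have -> : p ord0 i - q ord0 i = (p - q) ord0 i by rewrite !mxE.
rewrite /p /q /fine_point /pt frame_pointB; apply: frame_point_coord_le => //.
  exact: ltW.
by move=> k; have := dv k; rewrite !mxE.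
Qed.

(** If a planar line passes through the grid point, the other coordinates can be
    traced back to x = 0 without leaving the cube of size 2 H, so that the grid
    point is on the axis of a dilated tube, away from its ends. *)
Lemma tubes_contain_ball rho (z : 'rV[R]_d.+1) g : eps / 4 <= rho -> coarse_hits g ->
  (forall i, `|z ord0 i - coarse_point g ord0 i| <= eps / (4 * d.+1%:R)) ->
  (\bigcup_(T in tubes rho) tube_set (dilate 3 T)) z.
Proof.
move=> rhoe /asboolP[[s b] Bp]; rewrite /= => yE zg.
set x := N%:R^-1 + g.1%:R * eps in yE.
set y := grid_row (- H%:R) g.2 in yE.
have [w Sw sE] := BfS Bp; rewrite /= in sE.
have Ni0 : 0 < N%:R^-1 :> R by rewrite invr_gt0 ltr0n.
have epsN : eps <= N%:R^-1.
  by rewrite lef_pV2 ?posrE ?ltr0n ?muln_gt0 ?N0// ler_nat leq_pmulr.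
have x1 : x <= 1.
  have : g.1%:R * eps <= (N.-1 * Q)%:R * eps by rewrite ler_pM2r// ler_nat ltnW.
  have -> : (N.-1 * Q)%:R * eps = 1 - N%:R^-1 :> R.
    rewrite /eps !natrM -subn1 natrB//.
    by field; rewrite !pnatr_eq0 -!lt0n N0 Q0.
  by rewrite /x; lra.
have xN : N%:R^-1 <= x by rewrite /x lerDl mulr_ge0// ltW.
(* The point at x = 0 of the line with direction w through the grid point. *)
pose u := y - x *: w.
have yH k : `|y ord0 k| <= H%:R.
  rewrite mxE ler_norml.
  have : (g.2 k)%:R * eps <= (2 * H * (N * Q))%:R * eps by rewrite ler_pM2r// ler_nat ltnW.
  rewrite natrM -mulrA NQeps mulr1 natrM.
  have : 0 <= (g.2 k)%:R * eps by rewrite mulr_ge0// ltW.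
  by move=> ? ?; apply/andP; split; lra.
exists (tube_of rho w u).
  exists w, u; split => //.
    have -> : (w ord0 j - c, u ord0 j) = (s, b); last by [].
    congr (_, _); first exact: sE.
    move: yE; rewrite normr_le0 => /eqP yE; rewrite !mxE in yE *.
    by move: yE; rewrite -sE; lra.
  move=> k; rewrite !mxE; apply: le_trans (ler_normB _ _) _.
  have := yH k; rewrite !mxE.
  rewrite normrM (ger0_norm (_ : 0 <= x)); last lra.
  have := SlW k Sw; have := normr_ge0 (w ord0 k) => w0 wW.
  have : x * `|w ord0 k| <= 1 * W by apply: ler_pM; lra.
  by have := HW; lra.
have om1 := direction_norm_ge1 w; set om := enorm (pt 1 w) in om1 *.
have om0 : 0 < om by apply: lt_le_trans om1.
pose e := z - coarse_point g.
have ee : enorm e <= eps / 4.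
  have -> : eps / 4 = d.+1%:R * (eps / (4 * d.+1%:R)).
    by field; rewrite addrC natr1 pnatr_eq0.
  apply: enorm_le_coord => [|i]; first by rewrite divr_ge0 ?ltW.
  by have := zg i; rewrite !mxE.
(* Position along the axis relative to the centre, which lies over x = 3 / 2. *)
pose sp := (x - 3 / 2) * om.
have ax := axis_point rho w u sp.
have -> : z = centre (tube_of rho w u) + sp *: axis (tube_of rho w u) + e.
  rewrite ax /= -/om /sp mulfK ?gt_eqF//.
  have -> : 3 / 2 + (x - 3 / 2) = x by ring.
  by rewrite /u subrK /e /coarse_point -/x -/y addrC subrK.
apply: (@tube_set_near_axis _ _ (dilate 3 (tube_of rho w u)) sp e) => /=.
- exact: (axis_unit rho w u).
- rewrite -/om /sp normrM (gtr0_norm om0) ler0_norm; last lra.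
  have : N%:R^-1 * 1 <= x * om by apply: ler_pM; lra.
  by have := HW; lra.
- exact: le_trans rhoe.
Qed.

Lemma coarse_grid_sep (g g' : coarse_grid) : g != g' ->
  exists i, 2 * (eps / (4 * d.+1%:R)) < `|coarse_point g ord0 i - coarse_point g' ord0 i|.
Proof.
move=> gg'; apply: contrapT => /forallNP near.
have : enorm (coarse_point g - coarse_point g') <= d.+1%:R * (2 * (eps / (4 * d.+1%:R))).
  apply: enorm_le_coord => [|i]; first by rewrite mulr_ge0// divr_ge0 ?ltW.
  by have /negP := near i; rewrite -leNgt !mxE.
have -> : d.+1%:R * (2 * (eps / (4 * d.+1%:R))) = eps / 2 by field; rewrite addrC natr1 pnatr_eq0.
rewrite /coarse_point /pt frame_pointB.
have [nx nu'] := frame_point_enorm_ge onb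
  (N%:R^-1 + g.1%:R * eps - (N%:R^-1 + g'.1%:R * eps))
  (grid_row (- H%:R) g.2 - grid_row (- H%:R) g'.2).
have dist (a b : nat) (o : R) : a != b -> eps <= `|(o + a%:R * eps) - (o + b%:R * eps)|.
  move=> ab; have -> : o + a%:R * eps - (o + b%:R * eps) = (a%:R - b%:R) * eps by ring.
  rewrite normrM (gtr0_norm eps0); apply: ler_peMl; first exact: ltW.
  have : (a < b)%N || (b < a)%N by rewrite -neq_ltn.
  case/orP=> lt; last by rewrite -natrB 1?ltnW// ger0_norm// ler1n subn_gt0.
  by rewrite distrC -natrB 1?ltnW// ger0_norm// ler1n subn_gt0.
apply/negP; rewrite -ltNge.
move: gg'; case: g g' nx nu' {near} => [k f] [k' f'] /= nx nu'; rewrite xpair_eqE negb_and.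
case/orP=> [kk'|ff'].
  by apply: lt_le_trans nx; apply: lt_le_trans (dist _ _ _ kk'); have := eps0; lra.
have [l fl] : exists l, f l != f' l.
  apply: contrapT => /forallNP h; move/negP: ff'; apply; apply/eqP/ffunP => l.
  by apply/eqP; have /negP := h l; rewrite negbK.
apply: lt_le_trans (nu' l); rewrite !mxE; apply: lt_le_trans (dist _ _ _ fl); have := eps0; lra.
Qed.

End TubeFamily.

(** * Harmonic sums and averaging *)

Section Harmonic.
Variable R : realType.

Definition harmonic_tail (M : nat) : R := \sum_(l < M) (l%:R + 3)^-1.

Lemma harmonic_tail_ge0 M : 0 <= harmonic_tail M.
Proof. by apply: sumr_ge0 => l _; rewrite invr_ge0 addr_ge0. Qed.

Lemma harmonic_tail_gt0 M : (0 < M)%N -> 0 < harmonic_tail M.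
Proof.
case: M => // M _; rewrite /harmonic_tail big_ord_recr/=.
apply: ltr_wpDl; first exact: harmonic_tail_ge0.
by rewrite invr_gt0 ltr_wpDl.
Qed.

Lemma harmonic_tail_unbounded (K : R) : exists2 M, (0 < M)%N & K <= harmonic_tail M.
Proof.
(* The M + 3 terms from M on are at least 1 / (2 (M + 3)). *)
have dbl M : harmonic_tail M + 2^-1 <= harmonic_tail (M + (M + 3)).
  rewrite /harmonic_tail big_split_ord/= lerD2l.
  apply: (@le_trans _ _ (\sum_(i < M + 3) ((2 * (M + 3))%:R)^-1)).
    rewrite sumr_const card_ord -(mulr_natr (_%:R^-1)) natrM invfM -mulrA mulVf ?mulr1//.
  apply: ler_sum => i _; rewrite lef_pV2 ?posrE.
  - by rewrite -natrD ler_nat; have := ltn_ord i; lia.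
  - by rewrite ltr0n; lia.
  - by rewrite ltr_wpDl.
have H m : exists2 M, (0 < M)%N & m%:R / 2 <= harmonic_tail M.
  elim: m => [|m [M M0 IH]].
    by exists 1%N => //; rewrite mul0r harmonic_tail_ge0.
  exists (M + (M + 3))%N; first by lia.
  by apply: le_trans (dbl M); rewrite -natr1 mulrDl mul1r lerD2r.
have [M M0 HM] := H (Num.bound (2 * `|K|)); exists M => //.
apply: le_trans HM; rewrite ler_pdivlMr// mulrC.
apply: le_trans (_ : _ <= 2 * `|K|) _; first by rewrite ler_pM2l// ler_norm.
by apply: ltW; apply: archi_boundP; rewrite mulr_ge0.
Qed.

(** Within a block of [Q] consecutive terms the summand is at least its value at the
    end of the block. *)
Lemma coarse_sum (N Q : nat) : (0 < N)%N -> (0 < Q)%N ->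
  Q%:R * harmonic_tail N.-1 <= \sum_(k < N.-1 * Q)
    1 / (1 + N%:R * (N%:R^-1 + k%:R * (N * Q)%:R^-1)) :> R.
Proof.
move=> N0 Q0; have QR : 0 < Q%:R :> R by rewrite ltr0n.
have E k : 1 + N%:R * (N%:R^-1 + k%:R * (N * Q)%:R^-1) = 2 + k%:R / Q%:R :> R.
  by rewrite natrM; field; rewrite !pnatr_eq0 -!lt0n N0 Q0.
under eq_bigr do rewrite E; elim: N.-1 => [|M IH].
  by rewrite mul0n big_ord0 /harmonic_tail big_ord0 mulr0.
rewrite /harmonic_tail big_ord_recr/= mulrDr mulSnr big_split_ord/= lerD//.
apply: (@le_trans _ _ (\sum_(i < Q) (M%:R + 3)^-1)).
  by rewrite sumr_const card_ord mulr_natl.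
apply: ler_sum => i _; rewrite div1r lef_pV2 ?posrE.
- rewrite natrD natrM mulrDl mulfK ?gt_eqF//.
  have : i%:R / Q%:R <= 1 :> R by rewrite ler_pdivrMr// mul1r ler_nat ltnW.
  by lra.
- by rewrite ltr_wpDl.
- by rewrite ltr_wpDr// divr_ge0.
Qed.

End Harmonic.

Section Averaging.
Variables (R : realType).

(** First moment method.  The factor 1/2 makes the inequality strict, so that the
    index found has [h i] nonempty. *)
Lemma exists_good_index (I G G' : finType) (f : I -> pred G) (h : I -> pred G')
    (al be : R) : (0 < #|I|)%N -> 0 < al -> 0 < be ->
  \sum_g \sum_i (f i g)%:R <= al * #|I|%:R ->
  be * #|I|%:R <= \sum_g \sum_i (h i g)%:R ->
  exists i, be / 2 * #|f i|%:R < al * #|h i|%:R.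
Proof.
move=> I0 al0 be0 sf sh; apply: contrapT => /forallNP none.
have IR : 0 < #|I|%:R :> R by rewrite ltr0n.
have card (J : finType) (u : I -> pred J) :
    \sum_g \sum_i (u i g)%:R = \sum_i #|u i|%:R :> R.
  rewrite exchange_big; apply: eq_bigr => i _; rewrite -natr_sum -sum1_card [X in _ = X%:R]big_mkcond/=.
  by congr _%:R; apply: eq_bigr => g _; rewrite unfold_in; case: (u i g).
have : al * (be * #|I|%:R) <= be / 2 * (al * #|I|%:R).
  apply: le_trans (_ : al * \sum_i #|h i|%:R <= _); first by rewrite -card ler_wpM2l// ltW.
  apply: le_trans (_ : be / 2 * \sum_i #|f i|%:R <= _).
    by rewrite !mulr_sumr; apply: ler_sum => i _; have /negP := none i; rewrite -leNgt.
  by rewrite -card ler_wpM2l// divr_ge0// ltW.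
have : 0 < al * be * #|I|%:R by rewrite !mulr_gt0.
lra.
Qed.

End Averaging.

(** * Kakeya-type sets *)

Section Kakeya.
Variables (R : realType) (d : nat).

(** (2/7)^d compares the two cubes of grid points, the last factor the volumes of
    the covering and of the inscribed cubes; 32 comes from the planar bounds and the
    remaining factor 2 of 64 from the averaging. *)
Definition dim_const : R :=
  (2 / 7) ^+ d / 64 / (4 * d.+1%:R * d.+2%:R) ^+ d.+1.

Lemma dim_const_gt0 : 0 < dim_const.
Proof. by rewrite !divr_gt0// exprn_gt0// ?divr_gt0// !mulr_gt0. Qed.

Definition kakeya_tubes (Omega : set 'rV[R]_d.+1) (delta ratio : R)
    (P : set (tube R d.+1)) : Prop :=
  [/\ forall T, P T -> [/\ is_tube T, exists2 w, Omega w & oriented T w,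
        1 <= tlength T & tradius T <= delta],
    (0 < lebesgue_outer (\bigcup_(T in P) tube_set T) < +oo)%E &
    (ratio%:E * lebesgue_outer (\bigcup_(T in P) tube_set T) <=
       lebesgue_outer (\bigcup_(T in P) tube_set (dilate 3 T)))%E].

Lemma sum_fst (A B : finType) (F : A -> R) :
  \sum_(p : A * B) F p.1 = #|B|%:R * \sum_a F a.
Proof.
rewrite -(pair_bigA _ (fun a _ => F a))/= mulr_sumr.
by apply: eq_bigr => a _; rewrite sumr_const mulr_natl.
Qed.

Lemma fine_grid_card (H N Q : nat) : (0 < H)%N -> (0 < N)%N -> (0 < Q)%N ->
  #|{: fine_grid d H N Q}|%:R * (16 / N%:R) <= 32 * Q%:R * (7 * (H * (N * Q))%:R) ^+ d :> R.
Proof.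
move=> H0 N0 Q0; have NR : 0 < N%:R :> R by rewrite ltr0n.
rewrite card_prod card_ord card_ffun !card_ord natrM natrX.
apply: (@le_trans _ _ ((2 * (N * Q))%:R * (7 * (H * (N * Q))%:R) ^+ d * (16 / N%:R))).
  rewrite ler_wpM2r ?divr_ge0//; apply: ler_pM => //.
  - by rewrite ler_nat; nia.
  - rewrite lerXn2r ?nnegrE// -natrM ler_nat; nia.
rewrite !natrM le_eqVlt; apply/orP; left; apply/eqP; field.
by rewrite gt_eqF.
Qed.

(** The grid size 1 / (N Q) is chosen after the planar family, below its tolerance;
    the cube size [H] is chosen after the directions. *)
Lemma kakeya_tubes_exist (Omega : set 'rV[R]_d.+1) (N : nat) (delta : R) :
  (1 < N)%N -> 0 < delta -> sublacunary Omega ->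
  exists P, kakeya_tubes Omega delta (dim_const * harmonic_tail R N.-1) P.
Proof.
move=> N1 delta0 subl; have N0 : (0 < N)%N by lia.
have q0 : (0 < 2 * (64 * N))%N by lia.
have [nu [B [j [c [W [Sl [onb SlO SlW]]]]]]] := sublacunary_tree N0 q0 subl.
move=> /(sticky_family N0 (leqnn N))[I [Bf [eta [I0 eta0 BfS up lo]]]].
pose H := (Num.bound `|2 * W|).+1.
have HW : 2 * W <= H%:R.
  apply: le_trans (ler_norm _) _; apply: ltW; apply: lt_trans (archi_boundP _) _ => //.
  by rewrite ltr_nat.
have W0 : 0 <= `|W| by []; have WW := ler_norm W.
pose Q := (Num.bound ((1 + `|W|) / eta) + Num.bound delta^-1).+1.
have Q0 : (0 < Q)%N by []; have H0 : (0 < H)%N by [].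
have NQ0 : 0 < (N * Q)%:R :> R by rewrite ltr0n muln_gt0 N0.
set eps : R := (N * Q)%:R^-1.
have eps0 : 0 < eps by rewrite invr_gt0.
have NQeps : (N * Q)%:R * eps = 1 by rewrite divff// gt_eqF.
have Qbig (t : R) : 0 <= t -> (Num.bound t <= Q)%N -> t <= (N * Q)%:R.
  move=> t0 tQ; apply: ltW; apply: lt_le_trans (archi_boundP t0) _.
  by rewrite ler_nat (leq_trans tQ)// leq_pmull.
have eps_eta : eps * (1 + W) <= eta.
  rewrite mulrC ler_pdivrMr// mulrC -ler_pdivrMr//.
  apply: le_trans (Qbig ((1 + `|W|) / eta) _ _).
  - by rewrite ler_pM2r ?invr_gt0// lerD2l.
  - by rewrite divr_ge0 ?ltW//; lra.
  - by rewrite /Q; lia.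
have eps_delta : eps <= delta.
  rewrite -[delta]invrK lef_pV2 ?posrE ?invr_gt0//; apply: Qbig; first by rewrite invr_ge0 ltW.
  by rewrite /Q; lia.
have eps1 : eps <= 1.
  by rewrite invf_le1// ler1n muln_gt0 N0.
have rho0 : 0 <= eps / 4 <= eps by apply/andP; split; lra.
pose X : R := (H * (N * Q))%:R.
have X0 : 0 < X by rewrite ltr0n !muln_gt0 N0 H0.
have h0 : 0 < harmonic_tail R N.-1 by apply: harmonic_tail_gt0; rewrite -ltnS prednK.
have Q0R : 0 < Q%:R :> R by rewrite ltr0n.
have [i hi] : exists i, (2 * X) ^+ d * (Q%:R * harmonic_tail R N.-1) / 2 *
    #|[pred g : fine_grid d H N Q | fine_hits j c (Bf i) eta g]|%:R <
    32 * Q%:R * (7 * X) ^+ d *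
    #|[pred g : coarse_grid d H N Q | coarse_hits j c (Bf i) g]|%:R.
  apply: (@exists_good_index R I (fine_grid d H N Q) (coarse_grid d H N Q)
    (fun i => [pred g | fine_hits j c (Bf i) eta g])
    (fun i => [pred g | coarse_hits j c (Bf i) g])) => //.
  - by rewrite !mulr_gt0// exprn_gt0// mulr_gt0.
  - by rewrite !mulr_gt0// exprn_gt0// mulr_gt0.
  - apply: le_trans (_ : _ <= #|{: fine_grid d H N Q}|%:R * (16 / N%:R) * #|I|%:R) _; last first.
      by rewrite ler_wpM2r//; exact: fine_grid_card.
    rewrite -mulrA -sum1_card natr_sum mulr_suml; apply: ler_sum => g _; rewrite mul1r.
    apply: le_trans (_ : _ <= 16 / (N%:R + 16) * #|I|%:R) _.
      apply: up; have : 0 <= g.1%:R * eps by rewrite mulr_ge0// ltW.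
      have : g.1%:R * eps <= (N * Q)%:R * eps.
        by rewrite ler_pM2r// ler_nat -ltnS.
      by rewrite NQeps -/eps; lra.
    rewrite ler_wpM2r// ler_wpM2l// lef_pV2 ?posrE ?ltr_wpDl ?ltr0n//.
    by rewrite lerDl.
  - apply: le_trans (_ : _ <= \sum_(g : coarse_grid d H N Q)
       1 / (1 + N%:R * (N%:R^-1 + g.1%:R * eps)) * #|I|%:R) _; last first.
      apply: ler_sum => g _; apply: lo; rewrite lerDl mulr_ge0 ?(ltW eps0)//=.
      have : g.1%:R * eps <= (N.-1 * Q)%:R * eps by rewrite ler_pM2r// ler_nat ltnW.
      have -> : (N.-1 * Q)%:R * eps = 1 - N%:R^-1 :> R.
        rewrite /eps !natrM -subn1 natrB//.
        by field; rewrite !pnatr_eq0 -!lt0n N0.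
      by rewrite -/eps; lra.
    rewrite -mulr_suml ler_wpM2r//.
    rewrite (sum_fst _ (fun k : 'I_(N.-1 * Q) => 1 / (1 + N%:R * (N%:R^-1 + k%:R * eps)))).
    rewrite card_ffun !card_ord natrX -mulnA natrM ler_wpM2l ?exprn_ge0 ?mulr_ge0//.
    exact: coarse_sum.
set cE := #|_| in hi; set cS := #|_| in hi.
pose P := tubes nu B j c Sl (Bf i) H (eps / 4).
have outE := @outer_le_boxes R d (fine_grid d H N Q)
  [pred g | fine_hits j c (Bf i) eta g] (@fine_point R d nu B H N Q) (d.+2%:R * eps)
  (\bigcup_(T in P) tube_set T).
have outS := @outer_ge_boxes R d.+1 (coarse_grid d H N Q)
  [pred g | coarse_hits j c (Bf i) g] (@coarse_point R d nu B H N Q) (eps / (4 * d.+1%:R))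
  (\bigcup_(T in P) tube_set (dilate 3 T)).
have {}outE := outE _ (fun z => tubes_cover onb SlW N0 Q0 HW eps_eta rho0).
have {}outE : (lebesgue_outer (\bigcup_(T in P) tube_set T) <=
   (cE%:R * (2 * (d.+2%:R * eps)) ^+ d.+1)%:E)%E.
  by apply: outE; rewrite mulr_ge0// ltW.
have r20 : 0 <= eps / (4 * d.+1%:R) by rewrite divr_ge0 ?ltW.
have {}outS : ((cS%:R * (2 * (eps / (4 * d.+1%:R))) ^+ d.+1)%:E <=
    lebesgue_outer (\bigcup_(T in P) tube_set (dilate 3 T)))%E.
  apply: outS => // [g g' _ _|g z hg]; first exact: coarse_grid_sep.
  exact: (tubes_contain_ball onb SlW (@BfS i) N0 Q0 HW (lexx _) hg).
have cS0 : (0 < cS)%N.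
  rewrite lt0n; apply/eqP => cS0; move: hi; rewrite cS0 mulr0 ltNge => /negP; apply.
  by rewrite mulr_ge0// divr_ge0// !mulr_ge0// ?exprn_ge0// ?mulr_ge0// ltW.
have tube_ok T : P T -> [/\ is_tube T, exists2 w, Omega w & oriented T w,
    1 <= tlength T & tradius T <= delta].
  move=> [w [u [Sw _ _ ->]]]; have om1 := direction_norm_ge1 onb w.
  have om0 : 0 < enorm (frame_point nu B 1 w) by apply: lt_le_trans om1.
  split=> //=; [split => //=| |lra].
  - exact: axis_unit.
  - by rewrite divr_gt0.
  - have [r [w' [r0 Ow' rw]]] := SlO w Sw; exists w' => //.
    by exists ((enorm (frame_point nu B 1 w))^-1 * r); rewrite /= rw scalerA.
exists P; split => //.
  apply/andP; split; last exact: le_lt_trans outE (ltry _).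
  have /card_gt0P[g hg] := cS0.
  have [|T PT _] := tubes_contain_ball onb SlW (@BfS i) N0 Q0 HW (lexx _) hg
    (z := coarse_point nu B g).
    by move=> k; rewrite subrr normr0.
  have [[al1 _ _] _ T1 _] := tube_ok T PT.
  have radT : tradius T = eps / 4 by case: PT => w [u [_ _ _ ->]].
  have := @outer_ge_boxes R d.+1 unit predT (fun=> centre T) (eps / (4 * d.+1%:R))
    (\bigcup_(T in P) tube_set T) r20.
  move=> H1; apply: lt_le_trans (H1 _ _).
  - rewrite lte_fin mulr_gt0 ?exprn_gt0// ?mulr_gt0// ?divr_gt0// ltr0n.
    by apply/card_gt0P; exists tt.
  - by move=> [] [].
  - move=> _ z _ zT; exists T => //.
    pose e := z - centre T.
    have ee : enorm e <= eps / 4.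
      have -> : eps / 4 = d.+1%:R * (eps / (4 * d.+1%:R)).
        by field; rewrite addrC natr1 pnatr_eq0.
      by apply: enorm_le_coord => // k; have := zT k; rewrite !mxE.
    have -> : z = centre T + 0 *: axis T + e by rewrite scale0r addr0 /e addrC subrK.
    apply: tube_set_near_axis => //; last by rewrite radT.
    by rewrite normr0 add0r; lra.
apply: le_trans outS; apply: le_trans (lee_wpmul2l _ outE) _.
  by rewrite lee_fin mulr_ge0// ltW// dim_const_gt0.
rewrite -EFinM lee_fin.
have -> : 2 * (d.+2%:R * eps) = 4 * d.+1%:R * d.+2%:R * (2 * (eps / (4 * d.+1%:R))).
  by field; rewrite addrC natr1 pnatr_eq0.
set r := 2 * (eps / _); have r0 : 0 <= r by rewrite mulr_ge0.
rewrite exprMn /dim_const; set D := (4 * d.+1%:R * d.+2%:R) ^+ d.+1.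
have D0 : D != 0 by rewrite expf_neq0// !mulf_neq0// pnatr_eq0.
have -> : (2 / 7) ^+ d / 64 / D * harmonic_tail R N.-1 * (cE%:R * (D * r ^+ d.+1)) =
  (2 / 7) ^+ d / 64 * harmonic_tail R N.-1 * cE%:R * r ^+ d.+1 by field.
rewrite ler_wpM2r ?exprn_ge0//.
have Y0 : 0 < 32 * Q%:R * (7 * X) ^+ d by rewrite !mulr_gt0// exprn_gt0// mulr_gt0.
rewrite -(ler_pM2l Y0); apply: ltW; apply: le_lt_trans hi.
have -> : (2 * X) ^+ d = (2 / 7) ^+ d * (7 * X) ^+ d.
  by rewrite -exprMn; congr (_ ^+ _); field.
rewrite le_eqVlt; apply/orP; left; apply/eqP; by field.
Qed.

End Kakeya.

Theorem theorem1p2 (R : realType) (d : nat) (hd : (2 <= d)%N)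
  (Omega : set 'rV[R]_d.+1) (hOmega : ~ Omega 0) :
  sublacunary Omega -> admits_kakeya_type_sets Omega.
Proof.
move=> subl; pose delta (N : nat) : R := (N%:R + 2)^-1.
have delta0 N : 0 < delta N by rewrite invr_gt0 ltr_wpDl.
have /choice[P PP] : forall N : nat, exists P, kakeya_tubes Omega (delta N) N%:R P.
  move=> N; have k0 := dim_const_gt0 R d.
  have [M M0 HM] := harmonic_tail_unbounded (N%:R / dim_const R d).
  have [|P [P1 P2 P3]] := @kakeya_tubes_exist R d Omega M.+1 (delta N) _ (delta0 N) subl.
    by [].
  exists P; split => //; apply: le_trans P3; apply: lee_wpmul2r.
    by apply: ltW; have /andP[] := P2.
  by rewrite lee_fin mulrC -ler_pdivrMr.
exists 3; first by rewrite ler1n.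
exists delta, P; split.
- move=> N _; have := ler0n R N; rewrite delta0 /delta => ?; rewrite invf_lt1; lra.
- split.
    move=> M N /andP[_ MN]; rewrite lef_pV2 ?posrE ?ltr_wpDl//.
    by rewrite lerD2r ler_nat.
  apply: (@squeeze_cvgr _ _ _ _ (fun=> 0) (@harmonic R)) => //.
  + apply: nearW => N; rewrite ltW//= /delta /harmonic/= lef_pV2 ?posrE ?ltr_wpDl//.
    by rewrite -natr1; lra.
  + exact: cvg_cst.
  + exact: cvg_harmonic.
- by move=> N _ T /(let: And3 h _ _ := PP N in h).
- by move=> N _; have [] := PP N.
- apply/cvgeyPge => A; near=> N.
  have [_ /andP[E0 Efin] E3] := PP N.
  set E := lebesgue_outer _ in E0 Efin E3 *; set Es := lebesgue_outer _ in E3 *.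
  have Efn : E \is a fin_num by rewrite ge0_fin_numE// ltW.
  apply: le_trans (_ : (N%:R)%:E <= _)%E.
    rewrite lee_fin; near: N; exact: nbhs_infty_ger.
  have e0 : 0 < fine E by rewrite fine_gt0// E0.
  by rewrite -[in leRHS](fineK Efn) inver gt_eqF// lee_pdivlMr// fineK.
Unshelve. all: by end_near.
Qed.
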